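(* Let $\mathfrak{g}$ be a $6$-dimensional strongly unimodular almost nilpotent real Lie algebra with nilradical $\mathfrak{n}$ satisfying $\dim\mathfrak{n}^1=1$, where $\mathfrak{n}^1=[\mathfrak{n},\mathfrak{n}]$. Then $\mathfrak{g}$ admits balanced structures $(J,g)$ with $J\mathfrak{n}^1=\mathfrak{n}^{\perp_g}$ if and only if it is isomorphic to one of the following: - $\mathfrak{s}_{6.159}=(f^{24}+f^{35},0,-f^{56},0,f^{36},0)$, - $\mathfrak{s}_{6.162}^{1}=(f^{24}+f^{35},f^{26},f^{36},-f^{46},-f^{56},0)$, - $\mathfrak{s}_{6.165}^a=(f^{24}+f^{35},af^{26}+f^{36},-f^{26}+af^{36},-af^{46}+f^{56},-f^{46}-af^{56},0)$, $a>0$, - $\mathfrak{s}_{6.166}^a=(f^{24}+f^{35},-f^{46},-af^{56},f^{26},af^{36},0)$, $0<|a|\le1$, - $\mathfrak{s}_{6.167}=(f^{24}+f^{35},f^{36},-f^{26},f^{26}+f^{56},f^{36}-f^{46},0)$. On these Lie algebras, examples of such balanced structures are provided by the complex structure $Jf_1=f_6$, $Jf_2=-f_4$, $Jf_3=f_5$ on $\mathfrak{s}_{6.159}$ and $\mathfrak{s}_{6.166}^a$, and $Jf_1=f_6$, $Jf_2=f_3$, $Jf_4=f_5$ on the remaining ones, together with the metric for which the basis $\{f_1,\dots,f_6\}$ is orthonormal.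
   Context: The nilradical $\mathfrak{n}$ of a solvable Lie algebra $\mathfrak{g}$ is its maximal nilpotent ideal; $\mathfrak{g}$ is almost nilpotent if it is solvable and $\mathfrak{n}$ has codimension one. With $\mathfrak{n}^0=\mathfrak{n}$, $\mathfrak{n}^{l}=[\mathfrak{n},\mathfrak{n}^{l-1}]$, a solvable $\mathfrak{g}$ is strongly unimodular if $\operatorname{tr}(\mathrm{ad}_X|_{\mathfrak{n}^l/\mathfrak{n}^{l+1}})=0$ for all $X\in\mathfrak{g}$, $l\in\mathbb{N}$. A Hermitian structure $(J,g)$ on $\mathfrak{g}$ is an integrable complex structure $J$ (vanishing Nijenhuis tensor) together with a positive definite $J$-orthogonal inner product $g$; $\omega=g(J\cdot,\cdot)$. On a $2n$-dimensional Lie algebra it is balanced if $d\omega^{n-1}=0$, $d$ being the Chevalley–Eilenberg differential (here $n=3$). $\mathfrak{n}^{\perp_g}$ is the $g$-orthogonal complement of $\mathfrak{n}$ in $\mathfrak{g}$. $(\phi_1,\dots,\phi_6)$ denotes the Lie algebra with basis $\{f_k\}$ whose dual basis satisfies $df^k=\phi_k$, where $f^{kl}=f^k\wedge f^l$ and $d\alpha(X,Y)=-\alpha([X,Y])$. *)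

(* Defs.v *)
From HB Require Import structures.
From mathcomp Require Import all_boot all_order all_algebra all_fingroup.
From mathcomp Require Import ring.
From mathcomp Require Import reals.

Set Implicit Arguments.
Unset Strict Implicit.
Unset Printing Implicit Defensive.

Import Order.TTheory GRing.Theory Num.Theory.
Local Open Scope ring_scope.

HB.mixin Record Vector_isLieAlgebra (K : fieldType) L of Vector K L := {
  lie : L -> L -> L;
  lie_linearl : forall y : L, linear (fun x => lie x y);
  lie_linearr : forall x : L, linear (lie x);
  liexx : forall x : L, lie x x = 0;
  lie_jacobi : forall x y z : L,
    lie x (lie y z) + lie y (lie z x) + lie z (lie x y) = 0
}.

#[short(type="lieAlgType")]
HB.structure Definition LieAlgebra (K : fieldType) :=
  {L of Vector_isLieAlgebra K L & Vector K L}.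

HB.instance Definition _ (K : fieldType) (L : lieAlgType K) (x : L) :=
  GRing.isLinear.Build K L L *:%R (lie x) (lie_linearr x).

Section LieTheory.
Variables (K : fieldType) (L : lieAlgType K).
Implicit Types (U V W I n : {vspace L}).

Definition ad (x : L) : 'End(L) := linfun (lie x).

(* The span of all [u, v] with u in U and v in V; by bilinearity the brackets
   of basis vectors suffice (same encoding as the product of falgebra). *)
Definition lie_prod U V : {vspace L} :=
  <<[seq lie u v | u <- vbasis U, v <- vbasis V]>>%VS.

Definition lie_ideal I : bool := (lie_prod fullv I <= I)%VS.

Definition lower_central n (l : nat) : {vspace L} := iter l (lie_prod n) n.

Definition lie_nilpotent n : Prop := exists l, lower_central n l = 0%VS.

Definition derived_series U (l : nat) : {vspace L} :=
  iter l (fun V => lie_prod V V) U.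

Definition lie_solvable U : Prop := exists l, derived_series U l = 0%VS.

Definition is_nilradical n : Prop :=
  [/\ lie_ideal n, lie_nilpotent n &
      forall I, lie_ideal I -> lie_nilpotent I -> (I <= n)%VS].

Definition almost_nilpotent n : Prop :=
  lie_solvable fullv /\ (\dim n).+1 = \dim {:L}.

End LieTheory.

Definition lftrace (K : fieldType) (V : vectType K) (f : 'End(V)) : K :=
  \sum_i coord (vbasis {:V}) i (f (vbasis {:V})`_i).

(* For W <= U, the quotient U / W is modelled by the complement U :\: W of W in
   U, the quotient map being the projection addv_pi1 U W of U onto U :\: W along
   W. When f stabilises U and W, quot_end U W f is the endomorphism induced by f
   on U / W. *)
Definition quot_end (K : fieldType) (V : vectType K) (U W : {vspace V})
    (f : 'End(V)) : 'End(subvs_of (U :\: W)) :=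
  linfun (vsproj (U :\: W) \o addv_pi1 U W \o f \o vsval).

Definition strongly_unimodular (K : fieldType) (L : lieAlgType K)
    (n : {vspace L}) : Prop :=
  forall (x : L) (l : nat),
    lftrace (quot_end (lower_central n l) (lower_central n l.+1) (ad x)) = 0.

Definition lie_isom (K : fieldType) (L M : lieAlgType K) : Prop :=
  exists phi : 'Hom(L, M),
    bijective phi /\ forall x y, phi (lie x y) = lie (phi x) (phi y).

Section Forms.
Variables (K : fieldType) (L : lieAlgType K).

(* Alternation and multilinearity are not part of kform: they hold for the
   fundamental form of a Hermitian structure, and wedge and ce_diff preserve
   them. *)
Definition kform (k : nat) := ('I_k -> L) -> K.

Definition wedge p q (a : kform p) (b : kform q) : kform (p + q) := fun v =>
  (p`! * q`!)%:R^-1 * \sum_(s : 'S_(p + q)) (-1) ^+ s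
    * a (fun i => v (s (lshift q i))) * b (fun j => v (s (rshift p j))).

Fixpoint wedge_pow (w : kform 2) (m : nat) : kform m.*2 :=
  if m is m'.+1 then wedge w (@wedge_pow w m') else fun=> 1.

(* (d a)(v_0, ..., v_k) is the sum over i < i' of (-1)^(i + i') times
   a([v_i, v_i'], v_0, ..., v_k with v_i and v_i' omitted); the index i' <> i is
   written lift i j, and then lift i (lift j p) runs through the other indices.
   On 0-forms d vanishes. *)
Definition ce_diff (k : nat) : kform k -> kform k.+1 :=
  if k is k'.+1 then fun a v =>
    \sum_(i < k'.+2) \sum_(j < k'.+1 | (i < lift i j)%N)
      (-1) ^+ (i + lift i j)%N
      * a (fun m => if unlift ord0 m is Some p then v (lift i (lift j p))
                    else lie (v i) (v (lift i j)))
  else fun _ _ => 0.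

End Forms.

Section Hermitian.
Variables (R : realType) (L : lieAlgType R).
Implicit Types (J : 'End(L)) (g : {dot L for idfun}) (n : {vspace L}).

Definition nijenhuis J (x y : L) : L :=
  lie (J x) (J y) - J (lie (J x) y) - J (lie x (J y)) - lie x y.

Definition complex_structure J : Prop :=
  (forall x, J (J x) = - x) /\ (forall x y, nijenhuis J x y = 0).

Definition hermitian J g : Prop :=
  complex_structure J /\ (forall x y, g (J x) (J y) = g x y).

Definition fundamental_form J g : kform L 2 :=
  fun v => g (J (v ord0)) (v ord_max).

(* d (omega ^ (n - 1)) = 0, where \dim {:L} = 2 n. *)
Definition balanced J g : Prop :=
  hermitian J g /\
  forall v, ce_diff (@wedge_pow _ _ (fundamental_form J g) ((\dim {:L})./2).-1) v = 0.

Definition balanced_perp n J g : Prop :=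
  balanced J g /\ (J @: lower_central n 1)%VS = orthov g n.

End Hermitian.

(* Lie algebras given by structure equations. The form phi k is encoded by the
   matrix M with phi k (x, y) = x *m M *m y^T on row vectors; as
   d alpha (x, y) = - alpha [x, y], the k-th coordinate of [x, y] is
   - phi k (x, y). *)
Definition eqs_bracket (K : fieldType) N (phi : 'I_N -> 'M[K]_N)
    (x y : 'rV[K]_N) : 'rV[K]_N :=
  \row_k - (x *m phi k *m y^T) 0 0.

Fact eqs_bracketE (K : fieldType) N (phi : 'I_N -> 'M[K]_N) x y k :
  eqs_bracket phi x y 0 k = - (x *m phi k *m y^T) 0 0.
Proof. by rewrite mxE. Qed.

Fact eqs_bracket_linearl (K : fieldType) N (phi : 'I_N -> 'M[K]_N)
  (y : 'rV[K]_N) : linear (fun x => eqs_bracket phi x y).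
Proof.
move=> a u v; apply/rowP=> k.
have D m (A B : 'M[K]_(1, m)) j : (a *: A + B) 0 j = a * A 0 j + B 0 j.
  by rewrite !mxE.
by rewrite D !eqs_bracketE !mulmxDl -!scalemxAl D opprD mulrN.
Qed.

Fact eqs_bracket_linearr (K : fieldType) N (phi : 'I_N -> 'M[K]_N)
  (x : 'rV[K]_N) : linear (eqs_bracket phi x).
Proof.
move=> a u v; apply/rowP=> k.
have D m (A B : 'M[K]_(1, m)) j : (a *: A + B) 0 j = a * A 0 j + B 0 j.
  by rewrite !mxE.
by rewrite D !eqs_bracketE linearP mulmxDr -scalemxAr D opprD mulrN.
Qed.

Record structure_eqs (K : fieldType) (N : nat) := StructureEqs {
  eqs_form : 'I_N -> 'M[K]_N;
  eqs_alt : forall x, eqs_bracket eqs_form x x = 0;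
  eqs_jacobi : forall x y z,
    eqs_bracket eqs_form x (eqs_bracket eqs_form y z)
    + eqs_bracket eqs_form y (eqs_bracket eqs_form z x)
    + eqs_bracket eqs_form z (eqs_bracket eqs_form x y) = 0
}.

Definition lie_of_eqs (K : fieldType) N (E : structure_eqs K N) : Type :=
  'rV[K]_N.

Section LieOfEqs.
Variables (K : fieldType) (N : nat) (E : structure_eqs K N).

HB.instance Definition _ := Vector.on (lie_of_eqs E).


HB.instance Definition _ :=
  Vector_isLieAlgebra.Build K (lie_of_eqs E)
    (eqs_bracket_linearl (eqs_form E)) (eqs_bracket_linearr (eqs_form E))
    (eqs_alt E) (@eqs_jacobi _ _ E).

End LieOfEqs.

(* Indices 1, ..., 6 of the structure equations, as elements of 'I_6. *)
Definition ix (k : nat) : 'I_6 := inZp k.-1.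

Definition basis_vec (K : fieldType) (E : structure_eqs K 6) (k : nat) :
  lie_of_eqs E := delta_mx 0 (ix k).

Section Algebras.
Variable (K : fieldType).
Implicit Types (x y z : 'rV[K]_6) (a : K).

(* The 2-form f^{kl}, with f^{kl} (x, y) = x_k y_l - x_l y_k. *)
Definition f2 (k l : nat) : 'M[K]_6 :=
  delta_mx (ix k) (ix l) - delta_mx (ix l) (ix k).

Definition eqs6 (s : seq 'M[K]_6) : 'I_6 -> 'M[K]_6 := fun k => s`_k.

Definition phi_159 := eqs6
  [:: f2 2 4 + f2 3 5; 0; - f2 5 6; 0; f2 3 6; 0].

Definition phi_162_1 := eqs6
  [:: f2 2 4 + f2 3 5; f2 2 6; f2 3 6; - f2 4 6; - f2 5 6; 0].

Definition phi_165 a := eqs6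
  [:: f2 2 4 + f2 3 5; a *: f2 2 6 + f2 3 6; - f2 2 6 + a *: f2 3 6;
      - a *: f2 4 6 + f2 5 6; - f2 4 6 - a *: f2 5 6; 0].

Definition phi_166 a := eqs6
  [:: f2 2 4 + f2 3 5; - f2 4 6; - a *: f2 5 6; f2 2 6; a *: f2 3 6; 0].

Definition phi_167 := eqs6
  [:: f2 2 4 + f2 3 5; f2 3 6; - f2 2 6; f2 2 6 + f2 5 6; f2 3 6 - f2 4 6; 0].

Let ev (M : 'M[K]_6) x y := (x *m M *m y^T) 0 0.

Let evD M M' x y : ev (M + M') x y = ev M x y + ev M' x y.
Proof. by rewrite /ev mulmxDr mulmxDl mxE. Qed.

Let evZ a M x y : ev (a *: M) x y = a * ev M x y.
Proof. by rewrite /ev -scalemxAr -scalemxAl mxE. Qed.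

Let evN M x y : ev (- M) x y = - ev M x y.
Proof. by rewrite -scaleN1r evZ mulN1r. Qed.

Let ev0 x y : ev 0 x y = 0.
Proof. by rewrite /ev mulmx0 mul0mx mxE. Qed.

Let evf2 k l x y :
  ev (f2 k l) x y = x 0 (ix k) * y 0 (ix l) - x 0 (ix l) * y 0 (ix k).
Proof.
have ev_delta i j : ev (delta_mx i j) x y = x 0 i * y 0 j.
  by rewrite /ev -(mul_delta_mx (0 : 'I_1)) mulmxA -colE -mulmxA -rowE mxE
    big_ord1 !mxE.
by rewrite evD evN !ev_delta.
Qed.

Let eqs6E s x y k (lt_k6 : (k < 6)%N) :
  eqs_bracket (eqs6 s) x y 0 (ix k.+1) = - ev s`_k x y.
Proof. by rewrite eqs_bracketE /eqs6 /= modn_small. Qed.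

Let eqs6P (u v : 'rV[K]_6) :
  (forall k, (k < 6)%N -> u 0 (ix k.+1) = v 0 (ix k.+1)) -> u = v.
Proof.
move=> eq_uv; apply/rowP=> i; have := eq_uv i (ltn_ord i).
by rewrite /ix /= valZpK.
Qed.

Let row0E j : (0 : 'rV[K]_6) 0 j = 0. Proof. by rewrite mxE. Qed.

Let rowDE (u v : 'rV[K]_6) j : (u + v) 0 j = u 0 j + v 0 j.
Proof. by rewrite mxE. Qed.

Ltac eqs_ring :=
  move=> *; apply: eqs6P; move=> [|[|[|[|[|[|//]]]]]] _;
  rewrite row0E ?rowDE !eqs6E //= !(evD, evZ, evN, ev0, evf2) ?eqs6E //=
    ?(evD, evZ, evN, ev0, evf2); ring.

Fact phi_159_alt x : eqs_bracket phi_159 x x = 0.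
Proof. eqs_ring. Qed.

Fact phi_159_jacobi x y z (b := eqs_bracket phi_159) :
  b x (b y z) + b y (b z x) + b z (b x y) = 0.
Proof. rewrite /b; eqs_ring. Qed.

Definition s6_159 : structure_eqs K 6 :=
  StructureEqs phi_159_alt phi_159_jacobi.

Fact phi_162_1_alt x : eqs_bracket phi_162_1 x x = 0.
Proof. eqs_ring. Qed.

Fact phi_162_1_jacobi x y z (b := eqs_bracket phi_162_1) :
  b x (b y z) + b y (b z x) + b z (b x y) = 0.
Proof. rewrite /b; eqs_ring. Qed.

Definition s6_162_1 : structure_eqs K 6 :=
  StructureEqs phi_162_1_alt phi_162_1_jacobi.

Fact phi_165_alt a x : eqs_bracket (phi_165 a) x x = 0.
Proof. eqs_ring. Qed.

Fact phi_165_jacobi a x y z (b := eqs_bracket (phi_165 a)) :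
  b x (b y z) + b y (b z x) + b z (b x y) = 0.
Proof. rewrite /b; eqs_ring. Qed.

Definition s6_165 a : structure_eqs K 6 :=
  StructureEqs (phi_165_alt a) (phi_165_jacobi a).

Fact phi_166_alt a x : eqs_bracket (phi_166 a) x x = 0.
Proof. eqs_ring. Qed.

Fact phi_166_jacobi a x y z (b := eqs_bracket (phi_166 a)) :
  b x (b y z) + b y (b z x) + b z (b x y) = 0.
Proof. rewrite /b; eqs_ring. Qed.

Definition s6_166 a : structure_eqs K 6 :=
  StructureEqs (phi_166_alt a) (phi_166_jacobi a).

Fact phi_167_alt x : eqs_bracket phi_167 x x = 0.
Proof. eqs_ring. Qed.

Fact phi_167_jacobi x y z (b := eqs_bracket phi_167) :
  b x (b y z) + b y (b z x) + b z (b x y) = 0.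
Proof. rewrite /b; eqs_ring. Qed.

Definition s6_167 : structure_eqs K 6 :=
  StructureEqs phi_167_alt phi_167_jacobi.

End Algebras.

Section Examples.
Variables (R : realType) (E : structure_eqs R 6).
Local Notation f := (basis_vec E).

Definition J_16_24_35 (J : 'End(lie_of_eqs E)) : Prop :=
  [/\ J (f 1) = f 6, J (f 2) = - f 4 & J (f 3) = f 5].

Definition J_16_23_45 (J : 'End(lie_of_eqs E)) : Prop :=
  [/\ J (f 1) = f 6, J (f 2) = f 3 & J (f 4) = f 5].

(* Such J and g are unique, being determined on the basis f. *)
Definition balanced_example (specJ : 'End(lie_of_eqs E) -> Prop) : Prop :=
  exists (n : {vspace lie_of_eqs E}) (J : 'End(lie_of_eqs E))
         (g : {dot lie_of_eqs E for idfun}),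
    [/\ is_nilradical n, specJ J,
        orthonormal g [:: f 1; f 2; f 3; f 4; f 5; f 6] &
        balanced_perp n J g].

End Examples.

(* Main.v *)
From HB Require Import structures.
From mathcomp Require Import all_boot all_order all_algebra all_fingroup.
From mathcomp Require Import ring lra.
From mathcomp Require Import boolp reals.
Require Import Defs.

(** Write z for a generator of [n, n], e = J z, and k for the orthogonal
    complement of <z, e>, so that n = <z> + k and g = n + <e>.  Unimodularity
    on [n, n] makes z central, and integrability of J tested on (z, k) makes k
    stable under A = ad e, with A commuting with J.  On k one has
    [u, v] = eta (u, v) z, where eta is J-invariant and A is a derivation of
    eta.  The balanced condition, evaluated on (x, J x, y, J y, e), says that
    the trace of eta with respect to omega vanishes (here tr A = 0 is used):
    the Hermitian form attached to eta has signature (1, 1), and A lies in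
    u(1, 1).  Subtracting a multiple of J from A leaves B in su(1, 1), whose
    square is a real scalar; its sign separates the elliptic (s6.159 and
    s6.166, which include B = 0), parabolic (s6.167) and hyperbolic (s6.162 and
    s6.165) algebras.
    The remaining case, A nilpotent, would make g nilpotent. *)

Set Implicit Arguments.
Unset Strict Implicit.
Unset Printing Implicit Defensive.

Import Order.TTheory GRing.Theory Num.Theory.
Local Open Scope ring_scope.

(** * Lie brackets and traces on quotients *)

(** The frame of k is adapted to eta and not to g: x is non-isotropic for eta (u, J u), y is
    eta-orthogonal to x and J x and scaled to g (y, y) = g (x, x), while g (x, y) and g (x, J y)
    stay arbitrary. This avoids diagonalizing eta and g together, because for such a pair the trace
    condition reads exactly eta (y, J y) = - eta (x, J x). Before that condition is used eta may be
    degenerate, so the diagonal part of A at y is killed by unimodularity on n / [n, n], whereas the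
    derivation rule suffices at x.

    In the normal forms no vector is normalized: the common value of eta on the chosen pairs is
    absorbed into the central generator, and rescaling e brings the remaining parameter to the
    listed form.

    For the converse, the five algebras lie in two families of brackets, each with one complex
    structure for which d (omega ^ 2) = 0 is a polynomial identity. Uniqueness of the nilradical
    lets the structure travel along an isomorphism. *)

Section LieBasics.
Variables (K : fieldType) (L : lieAlgType K).
Implicit Types (x y z : L) (U V W I n : {vspace L}).

Lemma lieDl x y z : lie (x + y) z = lie x z + lie y z.
Proof. by have := lie_linearl z 1 x y; rewrite !scale1r. Qed.

Lemma lie0l z : lie 0 z = 0.
Proof. by apply: (addrI (lie 0 z)); rewrite -lieDl !addr0. Qed.

Lemma lieZl a x z : lie (a *: x) z = a *: lie x z.
Proof. by have := lie_linearl z a x 0; rewrite !addr0 lie0l addr0. Qed.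

Lemma lieDr x y z : lie x (y + z) = lie x y + lie x z.
Proof. exact: linearD. Qed.

Lemma lieZr a x z : lie x (a *: z) = a *: lie x z.
Proof. exact: linearZ. Qed.

Lemma lieNr x y : lie x (- y) = - lie x y.
Proof. exact: linearN. Qed.

Lemma lieC x y : lie x y = - lie y x.
Proof.
have := liexx (x + y); rewrite lieDl !lieDr !liexx add0r addr0 => /eqP.
by rewrite addr_eq0 => /eqP.
Qed.

Lemma lieNl x y : lie (- x) y = - lie x y.
Proof. by rewrite lieC lieNr [lie y x]lieC opprK. Qed.

Lemma lie_sumr (I : finType) (F : I -> L) x : lie x (\sum_i F i) = \sum_i lie x (F i).
Proof. exact: linear_sum. Qed.

Lemma lie_suml (I : finType) (F : I -> L) x : lie (\sum_i F i) x = \sum_i lie (F i) x.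
Proof.
by rewrite lieC lie_sumr -sumrN; apply: eq_bigr => i _; rewrite -lieC.
Qed.

Lemma lie_jacobiD x y z : lie x (lie y z) = lie (lie x y) z + lie y (lie x z).
Proof.
have /eqP := lie_jacobi x y z; rewrite -addrA addr_eq0 => /eqP ->.
by rewrite opprD addrC [lie z _]lieC opprK [lie z x]lieC lieNr opprK.
Qed.

Lemma adE x y : ad x y = lie x y.
Proof. by rewrite lfunE. Qed.

Lemma memv_lie_prod U V x y : x \in U -> y \in V -> lie x y \in lie_prod U V.
Proof.
move=> xU yV; rewrite (coord_vbasis xU) (coord_vbasis yV) lie_suml.
apply: memv_suml => i _; rewrite lie_sumr; apply: memv_suml => j _.
rewrite lieZr lieZl; apply/memvZ/memvZ/memv_span/allpairsP.
by exists ((vbasis U)`_i, (vbasis V)`_j); split; rewrite //= mem_nth ?size_tuple.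
Qed.

Lemma lie_prod_subP U V W :
  reflect (forall x y, x \in U -> y \in V -> lie x y \in W) (lie_prod U V <= W)%VS.
Proof.
apply: (iffP idP) => [/subvP sUVW x y xU yV|UVW].
  exact/sUVW/memv_lie_prod.
by apply/span_subvP=> _ /allpairsP[[x y] [/vbasis_mem xU /vbasis_mem yV ->]]; apply: UVW.
Qed.

Lemma lie_idealP I : reflect (forall x y, y \in I -> lie x y \in I) (lie_ideal I).
Proof.
apply: (iffP (lie_prod_subP _ _ _)) => [H x y|H x y _]; last exact: H.
by apply: H; rewrite memvf.
Qed.

Lemma lower_centralS n l : lower_central n l.+1 = lie_prod n (lower_central n l).
Proof. by []. Qed.

Lemma is_nilradical_uniq n n' : is_nilradical n -> is_nilradical n' -> n = n'.
Proof.
move=> [idn nn maxn] [idn' nn' maxn'].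
by apply/eqP; rewrite eqEsubv maxn ?maxn'.
Qed.

End LieBasics.

(** Each basis is expanded in the other and the two sums are exchanged; this frees [lftrace] from
    the basis chosen in its definition. *)
Lemma lftrace_basis (K : fieldType) (V : vectType K) k (X : k.-tuple V) (f : 'End(V)) :
  basis_of fullv X -> lftrace f = \sum_i coord X i (f X`_i).
Proof.
move=> bX; rewrite /lftrace; set Y := vbasis fullv.
have bY : basis_of fullv Y by exact: vbasisP.
have E (i : 'I_(\dim {:V})) : coord Y i (f Y`_i)
    = \sum_j coord X j Y`_i * coord Y i (f X`_j).
  rewrite {1}(coord_basis bX (memvf Y`_i)) !linear_sum.
  by apply: eq_bigr => j _; rewrite !linearZ.
under eq_bigr do rewrite E.
rewrite exchange_big; apply: eq_bigr => j _.
rewrite {2}(coord_basis bY (memvf (f X`_j))) linear_sum.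
by apply: eq_bigr => i _; rewrite linearZ mulrC.
Qed.

(** The projection pi has kernel W on U and W is stable, so f descends along pi. The images of
    vectors of U independent modulo W form a basis of the quotient, and the complement modelling it
    never has to be known. *)
Lemma lftrace_quot_end (K : fieldType) (V : vectType K) k (U W : {vspace V})
    (f : 'End(V)) (X : k.-tuple V)
    (c : 'I_k -> 'I_k -> K) :
    (W <= U)%VS -> (f @: W <= W)%VS ->
    (forall i : 'I_k, X`_i \in U) ->
    (forall d : 'I_k -> K, \sum_i d i *: X`_i \in W -> forall i, d i = 0) ->
    (k + \dim W)%N = \dim U ->
    (forall i : 'I_k, f X`_i - \sum_j c i j *: X`_j \in W) ->
  lftrace (quot_end U W f) = \sum_i c i i.
Proof.
move=> sWU fW XU freeX dimU fX.
pose pi : 'Hom(V, subvs_of (U :\: W)) := linfun (vsproj (U :\: W) \o addv_pi1 U W).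
have piE u : pi u = vsproj (U :\: W) (addv_pi1 U W u) by rewrite lfunE.
have vpi u : vsval (pi u) = addv_pi1 U W u by rewrite piE vsprojK ?memv_pi.
have piW u : u \in W -> pi u = 0.
  move=> uW; apply: subvs_inj; rewrite vpi linear0.
  have uUW : u \in (U + W)%VS by apply: subvP (addvSr U W) _ uW.
  have := addv_pi1_pi2 uUW; rewrite addv_pi2_id // => /(canRL (addrK _)).
  by rewrite subrr.
have ker_pi u : u \in U -> pi u = 0 -> u \in W.
  move=> uU /(congr1 vsval); rewrite vpi linear0 => pi0.
  have uUW : u \in (U + W)%VS by apply: subvP (addvSl U W) _ uU.
  by rewrite -(addv_pi1_pi2 uUW) pi0 add0r memv_pi2.
have subW u : u \in U -> u - vsval (pi u) \in W.
  move=> uU; rewrite vpi.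
  have uUW : u \in (U + W)%VS by apply: subvP (addvSl U W) _ uU.
  by rewrite -{1}(addv_pi1_pi2 uUW) addrAC subrr add0r memv_pi2.
have quotE u : u \in U -> quot_end U W f (pi u) = pi (f u).
  move=> uU; rewrite lfunE /= -piE.
  apply/eqP; rewrite eq_sym -subr_eq0.
  rewrite -linearB -linearB /=; apply/eqP/piW.
  by apply: (subvP fW); apply: memv_img; exact: subW.
pose Y := [tuple pi X`_i | i < k].
have YE (i : 'I_k) : Y`_i = pi X`_i by rewrite -tnth_nth tnth_mktuple.
have dimQ : \dim {: subvs_of (U :\: W)} = k.
  rewrite dimvf /dim /=.
  have := dimv_cap_compl U W; rewrite (capv_idPr sWU) -dimU addnC.
  by move/eqP; rewrite eqn_add2r => /eqP.
have freeY : free Y.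
  apply/freeP=> d; under eq_bigr do rewrite YE -linearZ.
  rewrite -linear_sum => /ker_pi dW; apply: freeX; apply: dW.
  by apply: memv_suml => i _; apply: memvZ.
have bY : basis_of fullv Y by rewrite basisEfree freeY subvf size_tuple dimQ leqnn.
rewrite (lftrace_basis (quot_end U W f) bY); apply: eq_bigr => i _.
rewrite YE quotE //.
have -> : pi (f X`_i) = \sum_j c i j *: Y`_j.
  under eq_bigr do rewrite YE -linearZ.
  rewrite -linear_sum; apply/eqP; rewrite -subr_eq0.
  by rewrite -linearB /= piW.
by rewrite coord_sum_free.
Qed.

(** * The square of a fundamental form *)

(** A permutation is determined by its value at 0 and a permutation of the other points; injectivity
    and (n+1)! = (n+1) n! give a bijection. Iterated, it expands the sums over permutations in
    [wedge] into explicit signed terms. *)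
Lemma sum_lift_perm (V : nmodType) n (F : 'S_n.+1 -> V) :
  \sum_s F s = \sum_i \sum_s F (lift_perm ord0 i s).
Proof.
pose f (p : 'I_n.+1 * 'S_n) := lift_perm ord0 p.1 p.2.
have f_inj : injective f.
  move=> [i s] [j t] /permP eq_f; have := eq_f ord0.
  rewrite !lift_perm_id /= => eq_ij; congr pair => //; apply/permP=> k.
  have := eq_f (lift ord0 k); rewrite !lift_perm_lift /= eq_ij.
  exact: lift_inj.
have f_bij : bijective f.
  by apply: inj_card_bij => //; rewrite card_prod !card_ord !card_Sn factS.
rewrite (reindex f) /=; last exact: onW_bij.
by rewrite pair_big.
Qed.

Section Wedge.
Variables (K : numFieldType) (L : lieAlgType K) (b : L -> L -> K).
Hypothesis b_skew : forall x y, b x y = - b y x.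
Let w : kform L 2 := fun v => b (v ord0) (v ord_max).

Lemma sum_perm0 (F : 'S_0 -> K) : \sum_s F s = F 1%g.
Proof.
by rewrite (big_pred1 1%g) // => s; apply/esym/eqP/permP=> -[].
Qed.

Lemma wedge_pow1 v : @wedge_pow K L w 1 v = b (v ord0) (v ord_max).
Proof.
rewrite /= /wedge /= sum_lift_perm.
under eq_bigr do rewrite sum_lift_perm.
under eq_bigr => i _ do under eq_bigr => j _ do rewrite sum_perm0.
have l0 : lshift 0 (ord0 : 'I_2) = ord0 by apply: val_inj.
have l1 : lshift 0 (ord_max : 'I_2) = lift ord0 ord0 by apply: val_inj.
rewrite !big_ord_recl !big_ord0 /w l0 l1 !lift_perm_lift !lift_perm_id.
rewrite !odd_lift_perm odd_perm1 /=.
have -> : lift ord0 ord0 = ord_max :> 'I_2 by apply: val_inj.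
have -> : lift ord_max ord0 = ord0 :> 'I_2 by apply: val_inj.
rewrite (b_skew (v ord_max)); rewrite (_ : (_ * _)%N = 2%N) //; by field.
Qed.

(** The Pfaffian of the skew 4 x 4 matrix of values of b. *)
Definition pf4 (x0 x1 x2 x3 : L) : K :=
  b x0 x1 * b x2 x3 - b x0 x2 * b x1 x3 + b x0 x3 * b x1 x2.

(** Each of the three pairings of four arguments comes from 8 permutations, and 8 / (2! 2!) = 2.
    Arguments are indexed by [nat] so that lifted indices compute. *)
Lemma wedge_pow2 (f : nat -> L) (v : 'I_4 -> L) : (forall i, v i = f i) ->
  @wedge_pow K L w 2 v = 2 * pf4 (f 0%N) (f 1%N) (f 2%N) (f 3%N).
Proof.
move=> vE.
rewrite [@wedge_pow K L w 2]/(wedge w (@wedge_pow K L w 1)) /wedge.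
under eq_bigr do rewrite [X in _ * X]wedge_pow1 /w !vE.
rewrite sum_lift_perm.
under eq_bigr do rewrite sum_lift_perm.
under eq_bigr do under eq_bigr do rewrite sum_lift_perm.
under eq_bigr do under eq_bigr do under eq_bigr do rewrite sum_lift_perm.
under eq_bigr do under eq_bigr do under eq_bigr do under eq_bigr do rewrite sum_perm0.
have l0 : lshift 2 (ord0 : 'I_2) = ord0 by apply: val_inj.
have l1 : lshift 2 (ord_max : 'I_2) = lift ord0 ord0 by apply: val_inj.
have l2 : rshift 2 (ord0 : 'I_2) = lift ord0 (lift ord0 ord0) by apply: val_inj.
have l3 : rshift 2 (ord_max : 'I_2) = lift ord0 (lift ord0 (lift ord0 ord0)) by apply: val_inj.
under eq_bigr do under eq_bigr do under eq_bigr do under eq_bigr do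
  rewrite [X in b (f X)]/= l0 l1 l2 l3 !lift_perm_lift !lift_perm_id !odd_lift_perm odd_perm1.
rewrite !big_ord_recl !big_ord0 /=.
rewrite /bump /= !add1n !add0n /= /pf4.
rewrite (b_skew (f 1%N) (f 0%N)) (b_skew (f 2%N) (f 0%N)) (b_skew (f 3%N) (f 0%N)).
rewrite (b_skew (f 2%N) (f 1%N)) (b_skew (f 3%N) (f 1%N)) (b_skew (f 3%N) (f 2%N)).
by rewrite (_ : (_ * _)%N = 4%N) //; field.
Qed.

(* Half of d (omega ^ 2), for omega u v = b u v. *)
Definition dpf (x0 x1 x2 x3 x4 : L) : K :=
    - pf4 (lie x0 x1) x2 x3 x4 + pf4 (lie x0 x2) x1 x3 x4
  - pf4 (lie x0 x3) x1 x2 x4 + pf4 (lie x0 x4) x1 x2 x3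
  - pf4 (lie x1 x2) x0 x3 x4 + pf4 (lie x1 x3) x0 x2 x4
  - pf4 (lie x1 x4) x0 x2 x3 - pf4 (lie x2 x3) x0 x1 x4
  + pf4 (lie x2 x4) x0 x1 x3 - pf4 (lie x3 x4) x0 x1 x2.

Lemma ce_diff_wedge_pow2 (f : nat -> L) (v : 'I_5 -> L) : (forall i, v i = f i) ->
  ce_diff (@wedge_pow K L w 2) v
  = 2 * dpf (f 0%N) (f 1%N) (f 2%N) (f 3%N) (f 4%N).
Proof.
move=> vE; rewrite [LHS]/=.
(* The arguments of the form with natural indices: [bump] reduces once i and j are concrete. *)
pose F (i j m : nat) :=
  if m is p.+1 then f (bump i (bump j p)) else lie (f i) (f (bump i j)).
have E (i : 'I_5) (j : 'I_4) : @wedge_pow K L w 2 (fun m => if unlift ord0 m is Some p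
    then v (lift i (lift j p)) else lie (v i) (v (lift i j)))
  = 2 * pf4 (F i j 0%N) (F i j 1%N) (F i j 2%N) (F i j 3%N).
  apply: wedge_pow2 => m.
  by case: (unliftP ord0 m) => [p ->|->]; rewrite /F /= ?add1n !vE.
transitivity (\sum_(i < 5) \sum_(j < 4 | (i < lift i j)%N) (-1) ^+ (i + lift i j)%N *
   (2 * pf4 (F i j 0%N) (F i j 1%N) (F i j 2%N) (F i j 3%N))).
  by apply: eq_bigr => i _; apply: eq_bigr => j _; rewrite -E.
under eq_bigr do rewrite big_mkcond.
rewrite !big_ord_recl !big_ord0 /= /F /bump /= !add1n !add0n /= /dpf.
set p := pf4.
ring.
Qed.
End Wedge.

(** * The balanced condition in dimension six *)

Section Hermitian.
Variables (R : realType) (L : lieAlgType R).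
Implicit Types (J : 'End(L)) (g : {dot L for idfun}).

Lemma dotC (g : {dot L for idfun}) x y : g x y = g y x.
Proof. by rewrite hermC mul1r. Qed.

Lemma hermitian_skew J g x y : hermitian J g -> g (J x) y = - g (J y) x.
Proof.
move=> [[J2 _] gJ]; by rewrite -gJ J2 linearNl /= [g x _]dotC.
Qed.

Lemma balancedP J g : \dim {:L} = 6%N ->
  balanced J g <-> hermitian J g /\
    forall x0 x1 x2 x3 x4, dpf (fun x y => g (J x) y) x0 x1 x2 x3 x4 = 0.
Proof.
move=> dimL; have E : ((\dim {:L})./2).-1 = 2 by rewrite dimL.
rewrite /balanced E; split=> -[herm H]; split=> //.
  move=> x0 x1 x2 x3 x4.
  pose f k := nth 0 [:: x0; x1; x2; x3; x4] k.
  have := H (fun i : 'I_5 => f i).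
  rewrite (@ce_diff_wedge_pow2 _ _ (fun x y => g (J x) y) _ f) //; last first.
    by move=> x y; apply: hermitian_skew.
  by move=> /eqP; rewrite mulf_eq0 pnatr_eq0 /= => /eqP.
move=> v; rewrite (@ce_diff_wedge_pow2 _ _ (fun x y => g (J x) y) _ (fun k => v (inord k))).
- by rewrite H mulr0.
- by move=> x y; apply: hermitian_skew.
- by move=> i; rewrite inord_val.
Qed.

End Hermitian.

(** * Transport along an isomorphism *)

Section Transport.
Variables (K : fieldType) (L M : lieAlgType K) (f : 'Hom(L, M)).
Hypothesis f_lie : forall x y, f (lie x y) = lie (f x) (f y).

Lemma limg_lie_prod U V : (f @: lie_prod U V)%VS = lie_prod (f @: U) (f @: V).
Proof.
apply/eqP; rewrite eqEsubv; apply/andP; split.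
  apply/subvP=> _ /memv_imgP[x xUV ->]; rewrite memv_preim.
  apply: (subvP _ _ xUV); apply/lie_prod_subP=> u v uU vV.
  by rewrite -memv_preim f_lie memv_lie_prod ?memv_img.
apply/lie_prod_subP=> _ _ /memv_imgP[x xU ->] /memv_imgP[y yV ->].
by rewrite -f_lie memv_img ?memv_lie_prod.
Qed.

Lemma limg_lower_central n l :
  (f @: lower_central n l)%VS = lower_central (f @: n) l.
Proof. by elim: l => // l IHl; rewrite !lower_centralS limg_lie_prod IHl. Qed.

Lemma limg_lie_nilpotent n : lie_nilpotent n -> lie_nilpotent (f @: n)%VS.
Proof. by move=> [l nl]; exists l; rewrite -limg_lower_central nl limg0. Qed.

Lemma limg_lie_ideal I : limg f = fullv -> lie_ideal I -> lie_ideal (f @: I)%VS.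
Proof.
move=> f_surj /lie_idealP idI; apply/lie_idealP=> x _ /memv_imgP[y yI ->].
have /memv_imgP[x' _ ->] : x \in limg f by rewrite f_surj memvf.
by rewrite -f_lie memv_img ?idI.
Qed.

End Transport.

Section TransportIso.
Variables (K : fieldType) (L M : lieAlgType K) (f : 'Hom(L, M)).
Hypothesis f_bij : bijective f.
Hypothesis f_lie : forall x y, f (lie x y) = lie (f x) (f y).

Lemma bij_lker0 : lker f == 0%VS.
Proof. exact/lker0P/bij_inj. Qed.

Lemma bij_lfunK : cancel f (f^-1)%VF.
Proof. exact/lker0_lfunK/bij_lker0. Qed.

Lemma bij_limg : limg f = fullv.
Proof.
case: f_bij => g _ gK; apply/eqP; rewrite eqEsubv subvf; apply/subvP=> y _.
by rewrite -(gK y) memv_img ?memvf.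
Qed.

Lemma bij_lfunVK : cancel (f^-1)%VF f.
Proof. by move=> y; apply: limg_lfunVK; rewrite bij_limg memvf. Qed.

Lemma bij_inv_lie x y : (f^-1)%VF (lie x y) = lie ((f^-1)%VF x) ((f^-1)%VF y).
Proof. by apply: (can_inj bij_lfunK); rewrite f_lie !bij_lfunVK. Qed.

End TransportIso.

Section TransportNilradical.
Variables (K : fieldType) (L M : lieAlgType K) (f : 'Hom(L, M)).
Hypothesis f_bij : bijective f.
Hypothesis f_lie : forall x y, f (lie x y) = lie (f x) (f y).

Lemma bij_inv_bij : bijective (f^-1)%VF.
Proof. by exists f; [exact: bij_lfunVK | exact: bij_lfunK]. Qed.

Lemma limg_nilradical n : is_nilradical n -> is_nilradical (f @: n)%VS.
Proof.
move=> [idn nn maxn]; split.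
- exact: limg_lie_ideal (bij_limg f_bij) idn.
- exact: limg_lie_nilpotent.
move=> I idI nI.
have fV_lie := bij_inv_lie f_bij f_lie.
have /(limgS f) : (f^-1 @: I <= n)%VS.
  apply: maxn; last exact: limg_lie_nilpotent.
  exact: limg_lie_ideal (bij_limg bij_inv_bij) idI.
suff -> : (f @: (f^-1 @: I))%VS = I by [].
apply/vspaceP=> y; apply/memv_imgP/idP=> [[_ /memv_imgP[z zI ->] ->]|yI].
  by rewrite bij_lfunVK.
by exists ((f^-1)%VF y); rewrite ?memv_img ?bij_lfunVK.
Qed.

End TransportNilradical.

Section TransportBalanced.
Variables (R : realType) (L M : lieAlgType R) (f : 'Hom(L, M)).
Hypothesis f_bij : bijective f.
Hypothesis f_lie : forall x y, f (lie x y) = lie (f x) (f y).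
Variables (n : {vspace M}) (J : 'End(M)) (g : {dot M for idfun}).

(** It carries the bijectivity proof because positivity of the pulled-back form depends on it, and
    the dot product instance recovers it from the term. *)
Definition pull_form of bijective f := fun x y : L => g (f x) (f y).

Let pg := pull_form f_bij.

Fact pull_form_bilinear : bilinear_for *%R (idfun \; *%R) pg.
Proof.
by split=> [v|u] a x y; rewrite /pg /pull_form linearP ?linearPl ?linearPr.
Qed.

HB.instance Definition _ :=
  bilinear_isBilinear.Build R L L R *%R (idfun \; *%R) pg pull_form_bilinear.

Fact pull_form_sym x y : pg x y = (-1) ^+ false * idfun (pg y x).
Proof. by rewrite /pg /pull_form mul1r /= dotC. Qed.

HB.instance Definition _ :=
  isHermitianSesquilinear.Build R L false idfun pg pull_form_sym.

Fact pull_form_gt0 u : u != 0 -> 0 < pg u u.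
Proof.
move=> u0; apply: neq0_dnorm_gt0; apply: contra_neq u0 => fu0.
by apply: (bij_inj f_bij); rewrite fu0 linear0.
Qed.

HB.instance Definition _ := isDotProduct.Build R L pg pull_form_gt0.

Let pgD : {dot L for idfun} := pg.
Let fi := (f^-1)%VF.
Let J' := (fi \o J \o f)%VF.

Let pgE x y : pgD x y = g (f x) (f y).
Proof. by []. Qed.

Let J'E x : J' x = fi (J (f x)).
Proof. by rewrite !comp_lfunE. Qed.

Let fJ' x : f (J' x) = J (f x).
Proof. by rewrite J'E bij_lfunVK. Qed.

Lemma bij_dim : \dim {:L} = \dim {:M}.
Proof.
rewrite -(bij_limg f_bij) limg_dim_eq //.
by rewrite capfv; apply/eqP/bij_lker0.
Qed.

Lemma pull_balanced_perp : \dim {:M} = 6%N -> balanced_perp n J g ->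
  balanced_perp (fi @: n)%VS J' pgD.
Proof.
move=> dimM [/(balancedP _ _ dimM)[herm dpf0] perp].
have dimL : \dim {:L} = 6%N by rewrite bij_dim.
have [[J2 nij] gJ] := herm.
split.
  apply/(balancedP _ _ dimL); split.
    split; first split.
    - by move=> x; apply: (bij_inj f_bij); rewrite !fJ' J2 linearN.
    - move=> x y; apply: (bij_inj f_bij).
      rewrite /nijenhuis linear0 -[RHS](nij (f x) (f y)) /nijenhuis.
      have fB u v : f (u - v) = f u - f v by exact: linearB.
      by rewrite !(fB, fJ', f_lie).
    - by move=> x y; rewrite !pgE !fJ' gJ.
  move=> x0 x1 x2 x3 x4; rewrite -[RHS](dpf0 (f x0) (f x1) (f x2) (f x3) (f x4)).
  by rewrite /dpf /pf4 !pgE !fJ' !f_lie.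
have fi_lie := bij_inv_lie f_bij f_lie.
rewrite -limg_lower_central // -limg_comp.
have -> : (J' \o fi)%VF = (fi \o J)%VF.
  by apply/lfunP=> x; rewrite !comp_lfunE bij_lfunVK.
rewrite limg_comp perp; apply/vspaceP=> u; apply/memv_imgP/mem_orthovP.
  move=> [v /mem_orthovP vn ->] _ /memv_imgP[w wn ->].
  by rewrite [LHS]pgE !bij_lfunVK // vn.
move=> un; exists (f u); last by rewrite bij_lfunK.
apply/mem_orthovP=> w wn; rewrite -[w](bij_lfunVK f_bij).
by apply: (un (fi w)); rewrite memv_img.
Qed.

End TransportBalanced.

(** The preimage of n' is a nilradical of L, hence equal to n by uniqueness; so the structure pulled
    back from M is orthogonal to the right subspace. *)
Lemma lie_isom_balanced_perp (R : realType) (L M : lieAlgType R) n n' J g :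
    lie_isom L M -> \dim {:M} = 6%N -> @is_nilradical _ L n ->
    @is_nilradical _ M n' -> balanced_perp n' J g ->
  exists (J' : 'End(L)) (g' : {dot L for idfun}), balanced_perp n J' g'.
Proof.
move=> [f [f_bij f_lie]] dimM nil_n nil_n' bal.
have fi_lie := bij_inv_lie f_bij f_lie.
have -> : n = (f^-1 @: n')%VS.
  apply: is_nilradical_uniq nil_n _.
  exact: (limg_nilradical (bij_inv_bij f_bij) fi_lie nil_n').
by do 2!eexists; apply: (pull_balanced_perp f_bij f_lie dimM bal).
Qed.

(* Used with a P that fails at 0: then I cannot be nilpotent. *)
Lemma ad_stable_not_nilpotent (K : fieldType) (L : lieAlgType K) (I : {vspace L})
    (x y : L) (P : L -> Prop) :
    lie_nilpotent I -> x \in I -> y \in I -> P y ->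
    (forall z, P z -> P (lie x z)) -> P 0.
Proof.
move=> [l nl] xI yI Py Px.
suff [z] : exists2 z, z \in lower_central I l & P z by rewrite nl memv0 => /eqP->.
elim: l {nl} => [|l [z zl Pz]]; first by exists y.
by exists (lie x z); [exact: memv_lie_prod | exact: Px].
Qed.

(** * Coordinates on the algebras of the list *)

Section Coordinates.
Variables (K : fieldType) (E : structure_eqs K 6).
Local Notation L := (lie_of_eqs E).

Definition co (x : L) k : K := (x : 'rV[K]_6) 0 (ix k).

Definition row6 (a1 a2 a3 a4 a5 a6 : K) : L :=
  (\row_i nth 0 [:: a1; a2; a3; a4; a5; a6] i : 'rV[K]_6).

Lemma coD x y k : co (x + y) k = co x k + co y k. Proof. by rewrite /co mxE. Qed.
Lemma coN x k : co (- x) k = - co x k. Proof. by rewrite /co mxE. Qed.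
Lemma coB x y k : co (x - y) k = co x k - co y k. Proof. by rewrite coD coN. Qed.
Lemma coZ a x k : co (a *: x) k = a * co x k. Proof. by rewrite /co mxE. Qed.
Lemma co0 k : co 0 k = 0. Proof. by rewrite /co mxE. Qed.

Lemma co_row6 a1 a2 a3 a4 a5 a6 (x := row6 a1 a2 a3 a4 a5 a6) :
  (co x 1 = a1) * (co x 2 = a2) * (co x 3 = a3) * (co x 4 = a4) * (co x 5 = a5)
  * (co x 6 = a6).
Proof. by rewrite /co /x /row6; do !split; rewrite mxE. Qed.

Lemma co_inj x y :
  co x 1 = co y 1 -> co x 2 = co y 2 -> co x 3 = co y 3 -> co x 4 = co y 4 ->
  co x 5 = co y 5 -> co x 6 = co y 6 -> x = y.
Proof.
move=> e1 e2 e3 e4 e5 e6; apply/rowP=> i.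
have -> : i = ix i.+1 by rewrite /ix /= valZpK.
by case: i => -[|[|[|[|[|[|//]]]]]] ?.
Qed.

Lemma basis_vec_row6 :
  (basis_vec E 1 = row6 1 0 0 0 0 0) * (basis_vec E 2 = row6 0 1 0 0 0 0) *
  (basis_vec E 3 = row6 0 0 1 0 0 0) * (basis_vec E 4 = row6 0 0 0 1 0 0) *
  (basis_vec E 5 = row6 0 0 0 0 1 0) * (basis_vec E 6 = row6 0 0 0 0 0 1).
Proof.
by do !split; apply: co_inj; rewrite co_row6 /co mxE.
Qed.

Lemma dim_lie_of_eqs : \dim {:L} = 6%N.
Proof. by rewrite dimvf /dim /= mul1n. Qed.

Lemma co_lie x y k : co (lie x y) k =
   - ((x : 'rV[K]_6) *m eqs_form E (ix k) *m (y : 'rV[K]_6)^T) 0 0.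
Proof. exact: eqs_bracketE. Qed.

Lemma eval_formD (M N : 'M[K]_6) (x y : 'rV[K]_6) :
  (x *m (M + N) *m y^T) 0 0 = (x *m M *m y^T) 0 0 + (x *m N *m y^T) 0 0.
Proof. by rewrite mulmxDr mulmxDl mxE. Qed.

Lemma eval_formZ a (M : 'M[K]_6) (x y : 'rV[K]_6) :
  (x *m (a *: M) *m y^T) 0 0 = a * (x *m M *m y^T) 0 0.
Proof. by rewrite -scalemxAr -scalemxAl mxE. Qed.

Lemma eval_formN (M : 'M[K]_6) (x y : 'rV[K]_6) :
  (x *m (- M) *m y^T) 0 0 = - (x *m M *m y^T) 0 0.
Proof. by rewrite -scaleN1r eval_formZ mulN1r. Qed.

Lemma eval_form0 (x y : 'rV[K]_6) : (x *m 0 *m y^T) 0 0 = 0 :> K.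
Proof. by rewrite mulmx0 mul0mx mxE. Qed.

Lemma eval_f2 k l (x y : L) :
  ((x : 'rV[K]_6) *m f2 K k l *m (y : 'rV[K]_6)^T) 0 0
  = co x k * co y l - co x l * co y k.
Proof.
have ev_delta i j : ((x : 'rV[K]_6) *m delta_mx i j *m (y : 'rV[K]_6)^T) 0 0
   = (x : 'rV[K]_6) 0 i * (y : 'rV[K]_6) 0 j.
  by rewrite -(mul_delta_mx (0 : 'I_1)) mulmxA -colE -mulmxA -rowE mxE
    big_ord1 !mxE.
by rewrite eval_formD eval_formN !ev_delta.
Qed.

Definition eval_form := (eval_f2, eval_formD, eval_formN, eval_formZ, eval_form0).

End Coordinates.

(** * Two families of brackets containing the five algebras *)

Section Families.
Variables (K : fieldType) (E : structure_eqs K 6).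
Local Notation L := (lie_of_eqs E).

(* Here ad f6 rotates the planes <f2, f4> and <f3, f5>, with speeds p and q. *)
Definition rot_bracket (p q : K) := forall x y : L, lie x y = row6 E
  (co x 4 * co y 2 - co x 2 * co y 4 + (co x 5 * co y 3 - co x 3 * co y 5))
  (p * (co x 4 * co y 6 - co x 6 * co y 4))
  (q * (co x 5 * co y 6 - co x 6 * co y 5))
  (- (p * (co x 2 * co y 6 - co x 6 * co y 2)))
  (- (q * (co x 3 * co y 6 - co x 6 * co y 3)))
  0.

(* Here ad f6 is complex linear for the structure f2 -> f3, f4 -> f5, and both
   complex lines are isotropic for f24 + f35; f4 spans an eigenline. *)
Definition null_bracket (a c d : K) := forall x y : L, lie x y = row6 E
  (co x 4 * co y 2 - co x 2 * co y 4 + (co x 5 * co y 3 - co x 3 * co y 5))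
  (- (a * (co x 2 * co y 6 - co x 6 * co y 2)
      + c * (co x 3 * co y 6 - co x 6 * co y 3)))
  (c * (co x 2 * co y 6 - co x 6 * co y 2)
      - a * (co x 3 * co y 6 - co x 6 * co y 3))
  (a * (co x 4 * co y 6 - co x 6 * co y 4)
      - c * (co x 5 * co y 6 - co x 6 * co y 5)
      - d * (co x 2 * co y 6 - co x 6 * co y 2))
  (a * (co x 5 * co y 6 - co x 6 * co y 5)
      + c * (co x 4 * co y 6 - co x 6 * co y 4)
      - d * (co x 3 * co y 6 - co x 6 * co y 3))
  0.
End Families.

Ltac gen_co x :=
  move: (co x 1) (co x 2) (co x 3) (co x 4) (co x 5) (co x 6) => ? ? ? ? ? ?.

Ltac bracket_tac :=
  let x := fresh "x" in let y := fresh "y" in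
  move=> x y; apply: co_inj; rewrite co_lie co_row6 /= !eval_form /=;
  gen_co x; gen_co y; ring.

Lemma rot_bracket_159 (K : fieldType) : rot_bracket (s6_159 K) 0 1.
Proof. bracket_tac. Qed.

Lemma rot_bracket_166 (K : fieldType) (a : K) : rot_bracket (s6_166 a) 1 a.
Proof. bracket_tac. Qed.

Lemma null_bracket_162 (K : fieldType) : null_bracket (s6_162_1 K) 1 0 0.
Proof. bracket_tac. Qed.

Lemma null_bracket_165 (K : fieldType) (a : K) : null_bracket (s6_165 a) a 1 0.
Proof. bracket_tac. Qed.

Lemma null_bracket_167 (K : fieldType) : null_bracket (s6_167 K) 0 1 1.
Proof. bracket_tac. Qed.

(** * Nilradical and standard metric *)

Section Nilradical.
Variables (R : realType) (E : structure_eqs R 6).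
Local Notation L := (lie_of_eqs E).
Local Notation f := (basis_vec E).

Definition co6 (x : L) : R^o := co x 6.

Fact co6_linear : linear co6.
Proof. by move=> a x y; rewrite /co6 coD coZ. Qed.

HB.instance Definition _ := GRing.isLinear.Build R L R^o *:%R co6 co6_linear.

Definition nil6 : {vspace L} := lker (linfun co6).

Lemma mem_nil6 x : (x \in nil6) = (co x 6 == 0).
Proof. by rewrite memv_ker lfunE. Qed.

Definition std_dot (x y : L) : R :=
  co x 1 * co y 1 + co x 2 * co y 2 + co x 3 * co y 3
  + co x 4 * co y 4 + co x 5 * co y 5 + co x 6 * co y 6.

Fact std_dot_bilinear : bilinear_for *%R (idfun \; *%R) std_dot.
Proof.
by split=> [v|u] a x y; rewrite /std_dot !coD !coZ /=; ring.
Qed.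

HB.instance Definition _ :=
  bilinear_isBilinear.Build R L L R *%R (idfun \; *%R) std_dot std_dot_bilinear.

Fact std_dot_sym x y : std_dot x y = (-1) ^+ false * idfun (std_dot y x).
Proof. by rewrite /std_dot /= mul1r; ring. Qed.

HB.instance Definition _ :=
  isHermitianSesquilinear.Build R L false idfun std_dot std_dot_sym.

Fact std_dot_gt0 u : u != 0 -> 0 < std_dot u u.
Proof.
move=> u0; have ge0 k : 0 <= co u k * co u k by rewrite -expr2 sqr_ge0.
rewrite lt_neqAle; apply/andP; split; last by rewrite /std_dot !addr_ge0.
apply: contra_neq u0 => /esym/eqP; rewrite /std_dot !paddr_eq0 ?addr_ge0 //.
rewrite !mulf_eq0 !orbb => /andP[/andP[/andP[/andP[/andP[]]]]].
by do 6!move=> /eqP ?; apply: co_inj; rewrite co0.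
Qed.

HB.instance Definition _ := isDotProduct.Build R L std_dot std_dot_gt0.

Definition gstd : {dot L for idfun} := std_dot.

Lemma gstdE x y : gstd x y = co x 1 * co y 1 + co x 2 * co y 2 + co x 3 * co y 3
  + co x 4 * co y 4 + co x 5 * co y 5 + co x 6 * co y 6.
Proof. by []. Qed.

Lemma orthonormal_gstd : orthonormal gstd [:: f 1; f 2; f 3; f 4; f 5; f 6].
Proof.
by rewrite /orthonormal /= !gstdE !basis_vec_row6 !co_row6
  !(mulr0, mul0r, mulr1, add0r, addr0) !eqxx.
Qed.

Hypothesis lie_nil : forall x y : L, co x 6 = 0 -> co y 6 = 0 ->
  lie x y = row6 E (co x 4 * co y 2 - co x 2 * co y 4
                    + (co x 5 * co y 3 - co x 3 * co y 5)) 0 0 0 0 0.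
Hypothesis lie_co6 : forall x y : L, co (lie x y) 6 = 0.

Lemma lower_central_nil6 : lower_central nil6 1 = <[f 1]>%VS.
Proof.
apply/eqP; rewrite eqEsubv; apply/andP; split.
  apply/lie_prod_subP=> x y; rewrite !mem_nil6 => /eqP x6 /eqP y6.
  rewrite lie_nil //; set c := (_ + _); apply/vlineP; exists c.
  by apply: co_inj; rewrite basis_vec_row6 coZ !co_row6 ?mulr0 ?mulr1.
rewrite -memvE.
have -> : f 1 = lie (f 4) (f 2).
  rewrite lie_nil !basis_vec_row6 ?co_row6 //.
  by rewrite !(mulr0, mul0r, mulr1, subr0, addr0).
by apply: memv_lie_prod; rewrite mem_nil6 basis_vec_row6 co_row6.
Qed.

Variables (N : L -> R) (kappa : R).
Hypothesis kappa_neq0 : kappa != 0.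
Hypothesis N0 : N 0 = 0.
Hypothesis N3 : N (f 3) != 0.
Hypothesis N_lie : forall x y, co y 6 = 0 -> N (lie x y) = co x 6 ^+ 2 * kappa * N y.

Lemma is_nilradical_nil6 : is_nilradical nil6.
Proof.
split.
- by apply/lie_idealP=> x y _; rewrite mem_nil6 lie_co6.
- exists 2%N; apply/eqP; rewrite lower_centralS lower_central_nil6 -subv0.
  apply/lie_prod_subP=> x y; rewrite mem_nil6 => /eqP x6 /vlineP[c ->].
  rewrite lieZr memv0 lie_nil // basis_vec_row6 ?co_row6 //.
  by apply/eqP/co_inj; rewrite coZ !co_row6 co0 !(mulr0, subr0, addr0).
move=> I /lie_idealP idI nI; apply/subvP=> x xI; rewrite mem_nil6.
apply/negPn/negP=> x6.
have f36 : co (f 3) 6 = 0 by rewrite basis_vec_row6 co_row6.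
pose P z := co z 6 = 0 /\ N z != 0.
have Px z : P z -> P (lie x z).
  move=> [z6 Nz]; split; first exact: lie_co6.
  by rewrite N_lie // !mulf_neq0 // expf_neq0.
have yI : lie x (f 3) \in I by rewrite lieC memvN idI.
have [_] := ad_stable_not_nilpotent nI xI yI (Px _ (conj f36 N3)) Px.
by rewrite N0 eqxx.
Qed.

Lemma perp_nil6 (J : 'End(L)) : J (f 1) = f 6 ->
  (J @: lower_central nil6 1)%VS = orthov gstd nil6.
Proof.
move=> Jf1; rewrite lower_central_nil6 limg_line Jf1.
apply/vspaceP=> u; apply/vlineP/mem_orthovP.
  move=> [c ->] v; rewrite mem_nil6 => /eqP v6.
  by rewrite [LHS]gstdE basis_vec_row6 !coZ !co_row6 v6 !(mulr0, mul0r, addr0).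
move=> uP; exists (co u 6).
have uf k : f k \in nil6 -> gstd u (f k) = 0 by exact: uP.
have [u1 u2 u3 u4 u5] : [/\ co u 1 = 0, co u 2 = 0, co u 3 = 0, co u 4 = 0 & co u 5 = 0].
  by split; [have := uf 1 | have := uf 2 | have := uf 3 | have := uf 4 | have := uf 5];
    rewrite mem_nil6 gstdE !basis_vec_row6 !co_row6 !(mulr0, mulr1, addr0, add0r) eqxx;
    apply.
by apply: co_inj; rewrite coZ basis_vec_row6 !co_row6 ?mulr0 ?mulr1.
Qed.

End Nilradical.

(* On 6-tuples of scalars the identity d (omega ^ 2) = 0 is within reach of
   ring; through the coordinates of abstract vectors it is not. *)
Record vec6 (K : Type) := Vec6 { v1 : K; v2 : K; v3 : K; v4 : K; v5 : K; v6 : K }.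

Section Dpf.
Variables (K : comNzRingType) (b : vec6 K -> vec6 K -> K) (br : vec6 K -> vec6 K -> vec6 K).

Definition vpf4 x0 x1 x2 x3 := b x0 x1 * b x2 x3 - b x0 x2 * b x1 x3 + b x0 x3 * b x1 x2.
Definition vdpf x0 x1 x2 x3 x4 :=
    - vpf4 (br x0 x1) x2 x3 x4 + vpf4 (br x0 x2) x1 x3 x4
  - vpf4 (br x0 x3) x1 x2 x4 + vpf4 (br x0 x4) x1 x2 x3
  - vpf4 (br x1 x2) x0 x3 x4 + vpf4 (br x1 x3) x0 x2 x4
  - vpf4 (br x1 x4) x0 x2 x3 - vpf4 (br x2 x3) x0 x1 x4
  + vpf4 (br x2 x4) x0 x1 x3 - vpf4 (br x3 x4) x0 x1 x2.
End Dpf.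

Lemma dpf_vec6 (K : numFieldType) (L : lieAlgType K) (b : L -> L -> K) (c : L -> vec6 K)
    vb br x0 x1 x2 x3 x4 :
    (forall x y, b x y = vb (c x) (c y)) ->
    (forall x y, c (lie x y) = br (c x) (c y)) ->
  dpf b x0 x1 x2 x3 x4 = vdpf vb br (c x0) (c x1) (c x2) (c x3) (c x4).
Proof. by move=> bE lieE; rewrite /dpf /pf4 /vdpf /vpf4 !bE !lieE. Qed.

Definition rot_vbr (K : comNzRingType) (p q : K) x y := 
  let: Vec6 x1 x2 x3 x4 x5 x6 := x in let: Vec6 y1 y2 y3 y4 y5 y6 := y in
  Vec6 (x4 * y2 - x2 * y4 + (x5 * y3 - x3 * y5))
    (p * (x4 * y6 - x6 * y4)) (q * (x5 * y6 - x6 * y5))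
    (- (p * (x2 * y6 - x6 * y2))) (- (q * (x3 * y6 - x6 * y3))) 0.

Definition rot_vform (K : comNzRingType) (x y : vec6 K) : K :=
  let: Vec6 x1 x2 x3 x4 x5 x6 := x in let: Vec6 y1 y2 y3 y4 y5 y6 := y in
  - x6 * y1 + x4 * y2 - x5 * y3 - x2 * y4 + x3 * y5 + x1 * y6.

(** Here [f2, J f2] = f1 and [f3, J f3] = - f1 cancel in the trace condition, and ad f6 has trace
    zero for all p and q. *)
Lemma rot_vdpf (K : comNzRingType) (p q : K) x0 x1 x2 x3 x4 :
  vdpf (@rot_vform K) (rot_vbr p q) x0 x1 x2 x3 x4 = 0.
Proof.
case: x0 x1 x2 x3 x4 => ? ? ? ? ? ? [? ? ? ? ? ?] [? ? ? ? ? ?] [? ? ? ? ? ?] [? ? ? ? ? ?].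
rewrite /vdpf /vpf4 /rot_vform /rot_vbr; ring.
Qed.

Definition null_vbr (K : comNzRingType) (a c d : K) x y := 
  let: Vec6 x1 x2 x3 x4 x5 x6 := x in let: Vec6 y1 y2 y3 y4 y5 y6 := y in
  Vec6 (x4 * y2 - x2 * y4 + (x5 * y3 - x3 * y5))
    (- (a * (x2 * y6 - x6 * y2) + c * (x3 * y6 - x6 * y3)))
    (c * (x2 * y6 - x6 * y2) - a * (x3 * y6 - x6 * y3))
    (a * (x4 * y6 - x6 * y4) - c * (x5 * y6 - x6 * y5) - d * (x2 * y6 - x6 * y2))
    (a * (x5 * y6 - x6 * y5) + c * (x4 * y6 - x6 * y4) - d * (x3 * y6 - x6 * y3))
    0.

Definition null_vform (K : comNzRingType) (x y : vec6 K) : K :=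
  let: Vec6 x1 x2 x3 x4 x5 x6 := x in let: Vec6 y1 y2 y3 y4 y5 y6 := y in
  - x6 * y1 - x3 * y2 + x2 * y3 - x5 * y4 + x4 * y5 + x1 * y6.

(** The complex lines of f2 and f4 are both isotropic, [f2, J f2] = [f4, J f4] = 0, and ad f6 has
    trace a + a - a - a = 0. *)
Lemma null_vdpf (K : comNzRingType) (a c d : K) x0 x1 x2 x3 x4 :
  vdpf (@null_vform K) (null_vbr a c d) x0 x1 x2 x3 x4 = 0.
Proof.
case: x0 x1 x2 x3 x4 => ? ? ? ? ? ? [? ? ? ? ? ?] [? ? ? ? ? ?] [? ? ? ? ? ?] [? ? ? ? ? ?].
rewrite /vdpf /vpf4 /null_vform /null_vbr; ring.
Qed.

(** * Balanced structures on the two families *)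

Section StandardJ.
Variables (R : realType) (E : structure_eqs R 6).
Local Notation L := (lie_of_eqs E).
Local Notation f := (basis_vec E).

Definition crd (x : L) : vec6 R :=
  Vec6 (co x 1) (co x 2) (co x 3) (co x 4) (co x 5) (co x 6).

Definition rot_J_fun (x : L) : L :=
  row6 E (- co x 6) (co x 4) (- co x 5) (- co x 2) (co x 3) (co x 1).

Fact rot_J_linear : linear rot_J_fun.
Proof.
by move=> a x y; apply: co_inj; rewrite !(coD, coZ, co_row6) ?opprD ?mulrN.
Qed.

HB.instance Definition _ :=
  GRing.isLinear.Build R L L *:%R rot_J_fun rot_J_linear.

Definition rot_J : 'End(L) := linfun rot_J_fun.

Lemma rot_JE x : rot_J x =
  row6 E (- co x 6) (co x 4) (- co x 5) (- co x 2) (co x 3) (co x 1).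
Proof. by rewrite lfunE. Qed.

Definition null_J_fun (x : L) : L :=
  row6 E (- co x 6) (- co x 3) (co x 2) (- co x 5) (co x 4) (co x 1).

Fact null_J_linear : linear null_J_fun.
Proof.
by move=> a x y; apply: co_inj; rewrite !(coD, coZ, co_row6) ?opprD ?mulrN.
Qed.

HB.instance Definition _ :=
  GRing.isLinear.Build R L L *:%R null_J_fun null_J_linear.

Definition null_J : 'End(L) := linfun null_J_fun.

Lemma null_JE x : null_J x =
  row6 E (- co x 6) (- co x 3) (co x 2) (- co x 5) (co x 4) (co x 1).
Proof. by rewrite lfunE. Qed.

Lemma rot_J_spec : J_16_24_35 rot_J.
Proof.
by split; rewrite rot_JE !basis_vec_row6; apply: co_inj;
  rewrite !(coN, co_row6) ?oppr0.
Qed.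

Lemma null_J_spec : J_16_23_45 null_J.
Proof.
by split; rewrite null_JE !basis_vec_row6; apply: co_inj;
  rewrite !(coN, co_row6) ?oppr0.
Qed.

Lemma rot_balanced p q : rot_bracket E p q -> balanced rot_J (gstd E).
Proof.
move=> lieE; apply/balancedP; first exact: dim_lie_of_eqs.
split; first split; first split.
- move=> x; rewrite !rot_JE; apply: co_inj; by rewrite !(coN, co_row6) ?opprK.
- move=> x y; apply: co_inj; rewrite /nijenhuis !lieE !(coB, rot_JE, co_row6) co0;
  gen_co x; gen_co y; ring.
- move=> x y; rewrite !gstdE !rot_JE !co_row6; gen_co x; gen_co y; ring.
move=> x0 x1 x2 x3 x4.
rewrite (@dpf_vec6 _ _ _ crd (@rot_vform R) (rot_vbr p q)) ?rot_vdpf // => x y.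
  by rewrite gstdE rot_JE !co_row6 /=; gen_co x; gen_co y; ring.
by rewrite /crd lieE !co_row6.
Qed.

Lemma null_balanced a c d : null_bracket E a c d -> balanced null_J (gstd E).
Proof.
move=> lieE; apply/balancedP; first exact: dim_lie_of_eqs.
split; first split; first split.
- move=> x; rewrite !null_JE; apply: co_inj; by rewrite !(coN, co_row6) ?opprK.
- move=> x y; apply: co_inj; rewrite /nijenhuis !lieE !(coB, null_JE, co_row6) co0;
  gen_co x; gen_co y; ring.
- move=> x y; rewrite !gstdE !null_JE !co_row6; gen_co x; gen_co y; ring.
move=> x0 x1 x2 x3 x4.
rewrite (@dpf_vec6 _ _ _ crd (@null_vform R) (null_vbr a c d)) ?null_vdpf // => x y.
  by rewrite gstdE null_JE !co_row6 /=; gen_co x; gen_co y; ring.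
by rewrite /crd lieE !co_row6.
Qed.

(** Non-nilpotency is detected on the plane <f3, f5> alone, since p is 0 for s6.159. *)
Lemma rot_nilradical p q : rot_bracket E p q -> q != 0 -> is_nilradical (nil6 E).
Proof.
move=> lieE q0.
apply: (@is_nilradical_nil6 _ _ _ _ (fun x => co x 3 ^+ 2 + co x 5 ^+ 2) (q ^+ 2)).
- move=> x y x6 y6; rewrite lieE; apply: co_inj; rewrite !co_row6 // x6 y6;
  gen_co x; gen_co y; ring.
- by move=> x y; rewrite lieE co_row6.
- by rewrite expf_neq0.
- by rewrite !co0 expr0n addr0.
- by rewrite basis_vec_row6 !co_row6 expr0n expr1n addr0 oner_neq0.
- by move=> x y y6; rewrite lieE !co_row6 y6; gen_co x; gen_co y; ring.
Qed.

(** Modulo <f1, f4, f5>, ad f6 acts on the plane of f2 and f3 as a complex number of squared modulus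
    a ^ 2 + c ^ 2. *)
Lemma null_nilradical a c d : null_bracket E a c d -> a ^+ 2 + c ^+ 2 != 0 ->
  is_nilradical (nil6 E).
Proof.
move=> lieE q0.
apply: (@is_nilradical_nil6 _ _ _ _ (fun x => co x 2 ^+ 2 + co x 3 ^+ 2) (a ^+ 2 + c ^+ 2)).
- move=> x y x6 y6; rewrite lieE; apply: co_inj; rewrite !co_row6 // x6 y6;
  gen_co x; gen_co y; ring.
- by move=> x y; rewrite lieE co_row6.
- by [].
- by rewrite !co0 expr0n addr0.
- by rewrite basis_vec_row6 !co_row6 expr0n expr1n add0r oner_neq0.
- by move=> x y y6; rewrite lieE !co_row6 y6; gen_co x; gen_co y; ring.
Qed.

Lemma rot_balanced_perp p q : rot_bracket E p q -> balanced_perp (nil6 E) rot_J (gstd E).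
Proof.
move=> lieE; split; first exact: rot_balanced lieE.
have [Jf1 _ _] := rot_J_spec.
apply: perp_nil6 => // x y; rewrite lieE ?co_row6 // => x6 y6.
by apply: co_inj; rewrite !co_row6 // x6 y6; gen_co x; gen_co y; ring.
Qed.

Lemma null_balanced_perp a c d : null_bracket E a c d ->
  balanced_perp (nil6 E) null_J (gstd E).
Proof.
move=> lieE; split; first exact: null_balanced lieE.
have [Jf1 _ _] := null_J_spec.
apply: perp_nil6 => // x y; rewrite lieE ?co_row6 // => x6 y6.
by apply: co_inj; rewrite !co_row6 // x6 y6; gen_co x; gen_co y; ring.
Qed.

Lemma rot_example p q : rot_bracket E p q -> q != 0 ->
  balanced_example (@J_16_24_35 R E).
Proof.
move=> lieE q0; exists (nil6 E), rot_J, (gstd E); split.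
- exact: rot_nilradical lieE q0.
- exact: rot_J_spec.
- exact: orthonormal_gstd.
- exact: rot_balanced_perp lieE.
Qed.

Lemma null_example a c d : null_bracket E a c d -> a ^+ 2 + c ^+ 2 != 0 ->
  balanced_example (@J_16_23_45 R E).
Proof.
move=> lieE q0; exists (nil6 E), null_J, (gstd E); split.
- exact: null_nilradical lieE q0.
- exact: null_J_spec.
- exact: orthonormal_gstd.
- exact: null_balanced_perp lieE.
Qed.

Lemma example_transport (specJ : 'End(L) -> Prop) (L' : lieAlgType R) (n : {vspace L'}) :
    balanced_example specJ -> lie_isom L' L -> is_nilradical n ->
  exists (J : 'End(L')) (g : {dot L' for idfun}), balanced_perp n J g.
Proof.
move=> [n' [J [g [nil' _ _ bal]]]] isoL nil.
exact: lie_isom_balanced_perp isoL (dim_lie_of_eqs E) nil nil' bal.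
Qed.

End StandardJ.

(** * Recognizing an algebra of the list *)

(** The brackets dual to df^1 = f^24 + f^35; the minus signs come from d alpha (X, Y) = - alpha
    [X, Y]. The action of X6 is left free, to be matched with one of the two families. *)
Record heis_frame (K : fieldType) (L : lieAlgType K) (n : {vspace L})
    (X1 X2 X3 X4 X5 X6 : L) : Prop := HeisFrame {
  hf_neq0 : X1 != 0;
  hf_mem : [/\ X1 \in n, X2 \in n, X3 \in n, X4 \in n & X5 \in n];
  hf_notin : X6 \notin n;
  hf_central : forall z, lie X1 z = 0;
  hf_24 : lie X2 X4 = - X1;
  hf_35 : lie X3 X5 = - X1;
  hf_23 : lie X2 X3 = 0;
  hf_25 : lie X2 X5 = 0;
  hf_34 : lie X3 X4 = 0;
  hf_45 : lie X4 X5 = 0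
}.

Section Frame.
Variables (K : fieldType) (L : lieAlgType K) (n : {vspace L}) (E : structure_eqs K 6).
Variables (X1 X2 X3 X4 X5 X6 : L).
Hypothesis dimL : \dim {:L} = 6%N.
Hypothesis frame : heis_frame n X1 X2 X3 X4 X5 X6.
Local Notation M := (lie_of_eqs E).
Local Notation f := (basis_vec E).

Definition frame_map (v : M) : L :=
  co v 1 *: X1 + co v 2 *: X2 + co v 3 *: X3 + co v 4 *: X4 + co v 5 *: X5
  + co v 6 *: X6.

Fact frame_map_linear : linear frame_map.
Proof.
move=> a u v; rewrite /frame_map !coD !coZ !scalerDl !scalerDr !scalerA.
do 4!(rewrite [RHS]addrACA; congr (_ + _)); exact: addrACA.
Qed.

HB.instance Definition _ := GRing.isLinear.Build K M L *:%R frame_map frame_map_linear.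

Lemma frame_map_row6 a1 a2 a3 a4 a5 a6 : frame_map (row6 E a1 a2 a3 a4 a5 a6)
  = a1 *: X1 + a2 *: X2 + a3 *: X3 + a4 *: X4 + a5 *: X5 + a6 *: X6.
Proof. by rewrite /frame_map !co_row6. Qed.

(* Linear independence comes for free: bracketing a relation with X2, ..., X5
   isolates its coefficients. *)
Lemma frame_map_inj : injective frame_map.
Proof.
suff ker0 v : frame_map v = 0 -> v = 0.
  move=> u v uv; apply/eqP; rewrite -subr_eq0; apply/eqP/ker0.
  by rewrite linearB /= uv subrr.
case: frame => X0 [X1n X2n X3n X4n X5n] X6n c1 c24 c35 c23 c25 c34 c45 v0.
have v6 : co v 6 = 0.
  apply/eqP; apply: contraR X6n => v6n0.
  rewrite -[X6](scalerK v6n0) memvZ //.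
  move: v0; rewrite /frame_map addrC => /eqP; rewrite addr_eq0 => /eqP->.
  by rewrite memvN !memvD ?memvZ.
have lie0 z : lie (frame_map v) z = 0 by rewrite v0 lie0l.
have scal0 a : - (a *: X1) = 0 -> a = 0.
  by move=> /eqP; rewrite oppr_eq0 scaler_eq0 (negPf X0) orbF => /eqP.
move: (lie0 X4) (lie0 X5) (lie0 X2) (lie0 X3).
rewrite /frame_map v6 scale0r addr0 !lieDl !lieZl !c1 !liexx.
rewrite c24 c35 c23 c25 c34 c45 (lieC X4 X2) (lieC X5 X2) (lieC X3 X2).
rewrite (lieC X5 X3) (lieC X4 X3) (lieC X5 X4) c24 c35 c23 c25 c34 c45.
rewrite !(oppr0, scaler0, add0r, addr0, scalerN, opprK).
move=> /scal0 v2 /scal0 v3 /eqP; rewrite scaler_eq0 (negPf X0) orbF => /eqP v4.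
move=> /eqP; rewrite scaler_eq0 (negPf X0) orbF => /eqP v5.
have v1 : co v 1 = 0.
  apply/eqP; move: v0; rewrite /frame_map v2 v3 v4 v5 v6 !scale0r !addr0.
  by move/eqP; rewrite scaler_eq0 (negPf X0) orbF.
by apply: co_inj; rewrite co0.
Qed.

(** The leading 0 is padding: [X k] counts from 1, like [basis_vec]. *)
Let X k := nth 0 [:: 0; X1; X2; X3; X4; X5; X6] k.

Lemma frame_map_basis k : (0 < k < 7)%N -> frame_map (f k) = X k.
Proof.
by case: k => [|[|[|[|[|[|[|]]]]]]] // _; rewrite basis_vec_row6 frame_map_row6
  !(scale0r, scale1r, add0r, addr0).
Qed.

(** By antisymmetry and bilinearity the pairs k < l determine the bracket. The frame map goes from
    the listed algebra to L, injective between equal dimensions, so its inverse is the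
    isomorphism. *)
Lemma lie_isom_frame :
  (forall k l, (0 < k)%N -> (k < l)%N -> (l < 7)%N ->
     frame_map (lie (f k) (f l)) = lie (X k) (X l)) ->
  lie_isom L M.
Proof.
move=> lieX.
have lie_basis i j : frame_map (lie (delta_mx 0 i : M) (delta_mx 0 j : M))
   = lie (frame_map (delta_mx 0 i : M)) (frame_map (delta_mx 0 j : M)).
  have deltaE (k : 'I_6) : delta_mx 0 k = f k.+1 by rewrite /basis_vec /ix /= valZpK.
  have i7 : (i.+1 < 7)%N by rewrite ltnS.
  have j7 : (j.+1 < 7)%N by rewrite ltnS.
  rewrite !deltaE; case: (ltngtP i j) => [ltij|ltij|/val_inj ->].
  - by rewrite lieX // !frame_map_basis.
  - by rewrite lieC linearN /= lieX // [RHS]lieC !frame_map_basis.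
  - by rewrite !liexx linear0.
have lie_map u v : frame_map (lie u v) = lie (frame_map u) (frame_map v).
  have sumE (w : M) : w = \sum_i (w : 'rV[K]_6) 0 i *: (delta_mx 0 i : M).
    exact: row_sum_delta.
  have mapS (F : 'I_6 -> M) : frame_map (\sum_i F i) = \sum_i frame_map (F i).
    exact: linear_sum.
  have mapZ a w : frame_map (a *: w) = a *: frame_map w by exact: linearZ.
  rewrite {1 2}(sumE u) {1 2}(sumE v) !(lie_suml, mapS); apply: eq_bigr => i _.
  rewrite !(lie_sumr, mapS); apply: eq_bigr => j _.
  by rewrite !(lieZl, lieZr, mapZ) lie_basis.
have psi_bij : bijective (linfun frame_map).
  have k0 : lker (linfun frame_map) == 0%VS.
    by apply/lker0P=> u v; rewrite !lfunE => /frame_map_inj.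
  exists ((linfun frame_map)^-1)%VF; first exact: lker0_lfunK.
  move=> y; apply: limg_lfunVK.
  suff -> : limg (linfun frame_map) = fullv by apply: memvf.
  apply/eqP; rewrite eqEdim subvf limg_dim_eq ?dim_lie_of_eqs ?dimL //.
  by rewrite capfv; apply/eqP.
have psi_lie u v : linfun frame_map (lie u v) = lie (linfun frame_map u) (linfun frame_map v).
  by rewrite !lfunE.
exists ((linfun frame_map)^-1)%VF; split; first exact: bij_inv_bij.
by move=> u v; apply: bij_inv_lie.
Qed.

Ltac frame_tac lieE := case=> [|[|[|[|[|[|[|k]]]]]]] [|[|[|[|[|[|[|l]]]]]]] // _ _ _;
  rewrite lieE !basis_vec_row6 !co_row6 frame_map_row6 /X /=
    ?(mulr0, mul0r, mulr1, mul1r, subr0, sub0r, addr0, add0r, oppr0, opprK, mulrN, mulNr)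
    ?(scale0r, scale1r, scaleN1r, scaleNr) ?(addr0, add0r).

Lemma lie_isom_rot_frame p q : rot_bracket E p q ->
  lie X6 X2 = p *: X4 -> lie X6 X4 = - (p *: X2) ->
  lie X6 X3 = q *: X5 -> lie X6 X5 = - (q *: X3) -> lie_isom L M.
Proof.
case: frame => _ _ _ c1 c24 c35 c23 c25 c34 c45 lieE c62 c64 c63 c65.
apply: lie_isom_frame.
frame_tac lieE; rewrite ?(c1, c24, c35, c23, c25, c34, c45) //;
  by rewrite lieC ?(c62, c63, c64, c65) ?opprK.
Qed.

Lemma lie_isom_null_frame a c d : null_bracket E a c d ->
  lie X6 X2 = a *: X2 - c *: X3 + d *: X4 ->
  lie X6 X3 = c *: X2 + a *: X3 + d *: X5 ->
  lie X6 X4 = - (a *: X4) - c *: X5 ->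
  lie X6 X5 = c *: X4 - a *: X5 -> lie_isom L M.
Proof.
case: frame => _ _ _ c1 c24 c35 c23 c25 c34 c45 lieE c62 c63 c64 c65.
apply: lie_isom_frame.
frame_tac lieE; rewrite ?(c1, c24, c35, c23, c25, c34, c45) //;
  rewrite lieC ?(c62, c63, c64, c65) ?opprD ?opprK //.
Qed.

End Frame.

(** * Classification *)

Definition listed (R : realType) (L : lieAlgType R) : Prop :=
  lie_isom L (lie_of_eqs (s6_159 R))
  \/ lie_isom L (lie_of_eqs (s6_162_1 R))
  \/ (exists a : R, 0 < a /\ lie_isom L (lie_of_eqs (s6_165 a)))
  \/ (exists a : R, 0 < `|a| <= 1 /\ lie_isom L (lie_of_eqs (s6_166 a)))
  \/ lie_isom L (lie_of_eqs (s6_167 R)).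

Section Elliptic.
Variables (R : realType) (L : lieAlgType R) (n : {vspace L}).
Hypothesis dimL : \dim {:L} = 6%N.

(* The two planes have opposite signs for the bracket, so neither needs to be
   normalized: both are rescaled by the choice of z. *)
Lemma listed_elliptic (z v v' w w' e : L) (P Q : R) :
    z != 0 -> [/\ z \in n, v \in n, v' \in n, w \in n & w' \in n] -> e \notin n ->
    (forall u, lie z u = 0) ->
    lie v v' = z -> lie w w' = - z ->
    lie v w = 0 -> lie v w' = 0 -> lie v' w = 0 -> lie v' w' = 0 ->
    lie e v = P *: v' -> lie e v' = - (P *: v) ->
    lie e w = Q *: w' -> lie e w' = - (Q *: w) ->
    P != 0 \/ Q != 0 ->
  listed L.
Proof.
(* Exchanging the two planes replaces z by - z. *)
wlog lePQ : z v v' w w' P Q / `|Q| <= `|P|.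
  move=> IH z0 [z_in_n vn v'n wn w'n] en zc vv' ww' vw vw' v'w v'w' ev ev' ew ew' PQ.
  have [le|/ltW le] := leP `|Q| `|P|; first by apply: (IH z v v' w w' P Q).
  apply: (IH (- z) w w' v v' Q P); rewrite ?oppr_eq0 ?memvN //.
  - by move=> u; rewrite lieNl zc oppr0.
  - by rewrite opprK.
  - by rewrite lieC vw oppr0.
  - by rewrite lieC v'w oppr0.
  - by rewrite lieC vw' oppr0.
  - by rewrite lieC v'w' oppr0.
  - by case: PQ; [right | left].
move=> z0 [z_in_n vn v'n wn w'n] en zc vv' ww' vw vw' v'w v'w' ev ev' ew ew' PQ.
have P0 : P != 0.
  by case: PQ => // Q0; rewrite -normr_gt0 (lt_le_trans _ lePQ) ?normr_gt0.
have en' : - P^-1 *: e \notin n.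
  apply: contra en => /(memvZ (- P)); rewrite scalerA mulrNN divff // scale1r.
  by [].
have [Q0|Q0] := eqVneq Q 0.
  (* The plane turning with speed P takes the place of <f3, f5>, the one that f6 rotates in
     s6.159. *)
  left; have frame : heis_frame n z w v w' (- v') (- P^-1 *: e).
    split; rewrite ?memvN ?lieNr ?vv' //.
    - by rewrite lieC vw oppr0.
    - by rewrite lieC v'w !oppr0.
    - by rewrite lieC v'w' !oppr0.
  apply: (lie_isom_rot_frame dimL frame (@rot_bracket_159 R));
    rewrite ?lieNr ?lieZl ?ew ?ew' ?ev ?ev' ?Q0 ?scale0r ?oppr0 ?scaler0 //.
  - by rewrite scalerA mulNr mulVf // scale1r scaleN1r.
  - by rewrite scalerN opprK scalerA mulNr mulVf // scale1r scaleN1r.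
(* Dividing e by - P makes the first speed 1, the sign matching f4 = - v'; the ordering of the
   speeds bounds the second one. *)
right; right; right; left; exists (- (Q / P)); split.
  rewrite normr_gt0 oppr_eq0 mulf_neq0 ?invr_neq0 //= normrN normf_div.
  by rewrite ler_pdivrMr ?normr_gt0 // mul1r.
have frame : heis_frame n z v w (- v') w' (- P^-1 *: e).
  split; rewrite ?memvN ?lieNr ?lieNl ?vv' ?vw ?vw' ?v'w' ?oppr0 //.
  by rewrite lieC v'w !oppr0.
apply: (lie_isom_rot_frame dimL frame (@rot_bracket_166 R _));
  rewrite ?lieNr ?lieZl ?ew ?ew' ?ev ?ev' ?scalerN ?scalerA.
- by rewrite mulNr mulVf // scale1r scaleN1r.
- by rewrite opprK mulNr mulVf // scale1r scaleN1r.
- by rewrite mulNr mulrC.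
- by rewrite mulNr mulrC.
Qed.

End Elliptic.

Section Classify.
Variables (R : realType) (L : lieAlgType R) (n : {vspace L}).
Hypothesis dimL : \dim {:L} = 6%N.
Variables (z x x' y y' e : L) (c m s t : R).
Hypothesis z0 : z != 0.
Hypothesis mem_n : [/\ z \in n, x \in n, x' \in n, y \in n & y' \in n].
Hypothesis en : e \notin n.
Hypothesis zc : forall u, lie z u = 0.
Hypotheses (xx' : lie x x' = z) (yy' : lie y y' = - z).
Hypotheses (xy : lie x y = 0) (xy' : lie x y' = 0) (x'y : lie x' y = 0) (x'y' : lie x' y' = 0).

Definition vec (a b p q : R) : L := a *: x + b *: x' + p *: y + q *: y'.

Hypothesis ex : lie e x = vec 0 (c + m) s t.
Hypothesis ex' : lie e x' = vec (- (c + m)) 0 (- t) s.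
Hypothesis ey : lie e y = vec s (- t) 0 (c - m).
Hypothesis ey' : lie e y' = vec t s (- (c - m)) 0.
Hypothesis basis : forall u, exists a b p q k l, u = k *: z + vec a b p q + l *: e.
Hypothesis not_nil : ~ lie_nilpotent {:L}%VS.

Lemma vecZ k a b p q : k *: vec a b p q = vec (k * a) (k * b) (k * p) (k * q).
Proof. by rewrite /vec !scalerDr !scalerA. Qed.

Lemma vecN a b p q : - vec a b p q = vec (- a) (- b) (- p) (- q).
Proof. by rewrite -scaleN1r vecZ !mulN1r. Qed.

Lemma vecD a b p q a' b' p' q' :
  vec a b p q + vec a' b' p' q' = vec (a + a') (b + b') (p + p') (q + q').
Proof.
rewrite /vec !scalerDl.
by do 2!(rewrite [LHS]addrACA; congr (_ + _)); exact: addrACA.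
Qed.

Lemma lie_vec a b p q a' b' p' q' : lie (vec a b p q) (vec a' b' p' q')
  = (a * b' - b * a' - (p * q' - q * p')) *: z.
Proof.
rewrite /vec !(lieDl, lieDr, lieZl, lieZr) !liexx xx' yy' xy xy' x'y x'y'.
rewrite (lieC x' x) (lieC y' y) (lieC y x) (lieC y' x) (lieC y x') (lieC y' x').
rewrite xx' yy' xy xy' x'y x'y' !(oppr0, scaler0, addr0, add0r).
rewrite !(scalerN, scalerA) -!scaleNr -!scalerDl; congr (_ *: _); ring.
Qed.

(* So ad e = c J + B on the span of x, x' = J x, y, y' = J y, and B ^ 2 is the
   scalar s ^ 2 + t ^ 2 - m ^ 2. *)
Lemma lie_e_vec a b p q : lie e (vec a b p q) =
  vec (- (c + m) * b + s * p + t * q) ((c + m) * a - t * p + s * q)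
      (s * a - t * b - (c - m) * q) (t * a + s * b + (c - m) * p).
Proof.
rewrite {1}/vec !lieDr !lieZr ex ex' ey ey' !vecZ !vecD.
congr vec; ring.
Qed.

Lemma vec_in a b p q : vec a b p q \in n.
Proof. by case: mem_n => *; rewrite !memvD ?memvZ. Qed.

(** The common value of the two nonzero brackets is absorbed into X1 = l z. *)
Lemma vec_frame l k a2 b2 p2 q2 a4 b4 p4 q4 a3 b3 p3 q3 a5 b5 p5 q5 :
    l != 0 -> k != 0 ->
    a2 * b4 - b2 * a4 - (p2 * q4 - q2 * p4) = - l ->
    a3 * b5 - b3 * a5 - (p3 * q5 - q3 * p5) = - l ->
    a2 * b3 - b2 * a3 - (p2 * q3 - q2 * p3) = 0 ->
    a2 * b5 - b2 * a5 - (p2 * q5 - q2 * p5) = 0 ->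
    a3 * b4 - b3 * a4 - (p3 * q4 - q3 * p4) = 0 ->
    a4 * b5 - b4 * a5 - (p4 * q5 - q4 * p5) = 0 ->
  heis_frame n (l *: z) (vec a2 b2 p2 q2) (vec a3 b3 p3 q3) (vec a4 b4 p4 q4)
    (vec a5 b5 p5 q5) (k *: e).
Proof.
move=> l0 k0 h24 h35 h23 h25 h34 h45.
have [z_in_n _ _ _ _] := mem_n.
split; rewrite ?lie_vec ?h24 ?h35 ?h23 ?h25 ?h34 ?h45 ?scale0r ?scaleNr //.
- by rewrite scaler_eq0 negb_or l0.
- by split; rewrite ?vec_in ?memvZ.
- by apply: contra en => /(memvZ k^-1); rewrite scalerK.
- by move=> u; rewrite lieZl zc scaler0.
Qed.

Let D := s ^+ 2 + t ^+ 2.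

Lemma listed_of_elliptic : D < m ^+ 2 -> listed L.
Proof.
move=> ltD.
(* B ^ 2 = - th ^ 2. The root with the sign of m is taken because eta (v, J v) will be 2 (th ^ 2 + m
   th), which is then positive. *)
have [th [thE mth]] : exists th : R, th ^+ 2 = m ^+ 2 - D /\ 0 < m * th.
  have m0 : m != 0.
    apply: contraTneq ltD => ->.
    by rewrite expr0n -leNgt /D addr_ge0 ?sqr_ge0.
  have d0 : 0 < m ^+ 2 - D by rewrite subr_gt0.
  have r2 : Num.sqrt (m ^+ 2 - D) ^+ 2 = m ^+ 2 - D by rewrite sqr_sqrtr ?ltW.
  have r0 : 0 < Num.sqrt (m ^+ 2 - D) by rewrite sqrtr_gt0.
  exists (Num.sg m * Num.sqrt (m ^+ 2 - D)); split.
    by rewrite exprMn r2 sqr_sg m0 mul1r.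
  by rewrite mulrA [m * _]mulrC -normrEsg mulr_gt0 ?normr_gt0.
(* With v = (B + th J) x below, B v = th J v; w spans the orthogonal line. *)
pose h := m + th.
have H : s ^+ 2 + t ^+ 2 = (m - th) * h.
  by rewrite /h -subr_sqr thE /D; ring.
have mu0 : h ^+ 2 - (s ^+ 2 + t ^+ 2) != 0.
  have -> : h ^+ 2 - (s ^+ 2 + t ^+ 2) = 2 * (th ^+ 2 + m * th).
    by rewrite H /h; ring.
  rewrite mulf_neq0 ?pnatr_eq0 // gt_eqF // ltr_wpDl ?sqr_ge0 //.
have [z_in_n _ _ _ _] := mem_n.
apply: (@listed_elliptic _ _ n dimL ((h ^+ 2 - (s ^+ 2 + t ^+ 2)) *: z)
  (vec 0 h s t) (vec (- h) 0 (- t) s) (vec t s h 0) (vec (- s) t 0 h) e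
  (c + th) (c - th)).
- by rewrite scaler_eq0 negb_or mu0.
- by split; rewrite ?vec_in ?memvZ.
- by [].
- by move=> u; rewrite lieZl zc scaler0.
- by rewrite lie_vec; congr (_ *: _); ring.
- by rewrite lie_vec -scaleNr; congr (_ *: _); ring.
- by rewrite lie_vec -[RHS](scale0r z); congr (_ *: _); ring.
- by rewrite lie_vec -[RHS](scale0r z); congr (_ *: _); ring.
- by rewrite lie_vec -[RHS](scale0r z); congr (_ *: _); ring.
- by rewrite lie_vec -[RHS](scale0r z); congr (_ *: _); ring.
- rewrite lie_e_vec vecZ; congr vec; move: H; rewrite /h; nra.
- rewrite lie_e_vec vecZ vecN; congr vec; move: H; rewrite /h; nra.
- rewrite lie_e_vec vecZ; congr vec; move: H; rewrite /h; nra.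
- rewrite lie_e_vec vecZ vecN; congr vec; move: H; rewrite /h; nra.
- have [cth|] := eqVneq (c + th) 0; [right|by left].
  by apply: contraTneq mth => cth'; rewrite (_ : th = 0) ?mulr0 ?ltxx //; lra.
Qed.

(** B ^ 2 = r ^ 2 with r nonzero, and B commutes with J, so its eigenspaces are complex lines; they
    are isotropic because B is skew for eta. The factor m - r J in f4 corrects the phase of the
    pairing between the two lines so that [f2, J f4] = 0. *)
Lemma listed_of_hyperbolic : m ^+ 2 < D -> listed L.
Proof.
move=> ltD; have d0 : 0 < D - m ^+ 2 by rewrite subr_gt0.
have [r [rE r0 rc]] : exists r : R, [/\ r ^+ 2 = D - m ^+ 2, r != 0 &
    c != 0 -> r * c < 0].
  have r2 : Num.sqrt (D - m ^+ 2) ^+ 2 = D - m ^+ 2 by rewrite sqr_sqrtr ?ltW.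
  have r0 : 0 < Num.sqrt (D - m ^+ 2) by rewrite sqrtr_gt0.
  have [c0|c0] := ltP 0 c.
    exists (- Num.sqrt (D - m ^+ 2)); split; first by rewrite sqrrN.
      by rewrite oppr_eq0 gt_eqF.
    by move=> _; rewrite mulNr oppr_lt0 mulr_gt0.
  exists (Num.sqrt (D - m ^+ 2)); split=> //; first by rewrite gt_eqF.
  by move=> cn0; rewrite pmulr_rlt0 // lt_neqAle cn0.
(* f2 = B x + r x and f4 = (m - r J) (B x - r x) are isotropic, in the r- and
   (- r)-eigenspaces of B; the sign of r makes - r / c positive. *)
pose b := m ^+ 2 + r ^+ 2.
have H : s ^+ 2 + t ^+ 2 = b by rewrite /b rE /D; ring.
(* [lra] works linearly, so the products of [H] with r, m and b are supplied as facts. *)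
have Hr := congr1 (fun u => r * u) H; have Hm := congr1 (fun u => m * u) H.
have Hb := congr1 (fun u => b * u) H.
have bn0 : b != 0 by rewrite -H gt_eqF // (le_lt_trans _ ltD) ?sqr_ge0.
have l0 : - (2 * r * b) != 0 by rewrite oppr_eq0 !mulf_neq0 ?pnatr_eq0.
have frame k : k != 0 -> heis_frame n (- (2 * r * b) *: z)
    (vec r m s t) (vec (- m) r (- t) s)
    (vec 0 b (m * s + r * t) (m * t - r * s))
    (vec (- b) 0 (- (m * t - r * s)) (m * s + r * t)) (k *: e).
  move=> k0; apply: vec_frame => //; rewrite /b /= in H Hr Hm Hb *; first [ring | lra].
have lie2 : lie e (vec r m s t) = r *: vec r m s t + c *: vec (- m) r (- t) s.
  by rewrite lie_e_vec !vecZ vecD; congr vec; rewrite /b in H *; lra.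
have lie3 : lie e (vec (- m) r (- t) s) = - (c *: vec r m s t) + r *: vec (- m) r (- t) s.
  by rewrite lie_e_vec !vecZ vecN vecD; congr vec; rewrite /b in H *; lra.
set f2 := vec r m s t in frame lie2 lie3; set f3 := vec (- m) r _ _ in frame lie2 lie3.
have lie4 : lie e (vec 0 b (m * s + r * t) (m * t - r * s))
    = - (r *: vec 0 b (m * s + r * t) (m * t - r * s))
      + c *: vec (- b) 0 (- (m * t - r * s)) (m * s + r * t).
  by rewrite lie_e_vec !vecZ vecN vecD; congr vec; rewrite /b /= in Hr Hm *; lra.
have lie5 : lie e (vec (- b) 0 (- (m * t - r * s)) (m * s + r * t))
    = - (c *: vec 0 b (m * s + r * t) (m * t - r * s))
      - r *: vec (- b) 0 (- (m * t - r * s)) (m * s + r * t).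
  by rewrite lie_e_vec !vecZ !vecN vecD; congr vec; rewrite /b /= in Hr Hm *; lra.
set f4 := vec 0 b _ _ in frame lie4 lie5; set f5 := vec _ 0 _ _ in frame lie4 lie5.
have [c0|cn0] := eqVneq c 0.
  right; left.
  apply: (lie_isom_null_frame dimL (frame r^-1 _) (@null_bracket_162 R));
    rewrite ?invr_neq0 // lieZl ?lie2 ?lie3 ?lie4 ?lie5 c0
      !(scale0r, addr0, oppr0, add0r, sub0r, subr0);
    by rewrite ?scalerN scalerK ?scale1r.
right; right; left; exists (- (r / c)); split.
  have -> : r / c = r * c * c^-1 ^+ 2 by field.
  by rewrite oppr_gt0 pmulr_llt0 ?rc // exprn_even_gt0 //= invr_neq0.
have cE u : - c^-1 *: (c *: u) = - u by rewrite scalerA mulNr mulVf // scaleN1r.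
have rE' u : - c^-1 *: (r *: u) = - (r / c) *: u by rewrite scalerA mulNr mulrC.
have k0 : - c^-1 != 0 by rewrite oppr_eq0 invr_neq0.
apply: (lie_isom_null_frame dimL (frame _ k0) (@null_bracket_165 R (- (r / c)))).
- by rewrite lieZl lie2 scalerDr cE rE' scale1r scale0r addr0.
- by rewrite lieZl lie3 scalerDr scalerN cE rE' opprK scale1r scale0r addr0.
- by rewrite lieZl lie4 scalerDr scalerN cE rE' scale1r.
- by rewrite lieZl lie5 scalerDr !scalerN cE rE' opprK scale1r.
Qed.

Lemma listed_of_parabolic : m ^+ 2 = D -> m != 0 -> c != 0 -> listed L.
Proof.
move=> mD m0 c0; do 4!right.
(* f2 = - m J x + s y + t J y is isotropic, and f4 = k J B x is in ker B. *)
pose k := 2 * m / c.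
have k0 : k != 0 by rewrite !mulf_neq0 ?pnatr_eq0 ?invr_neq0.
have kc : k * c = 2 * m by rewrite divfK.
(* [eqD] proves equalities modulo m ^ 2 = D, given the multiple of the relation. *)
rewrite /D in mD; have eqD a u v : u - v = a * (m ^+ 2 - (s ^+ 2 + t ^+ 2)) -> u = v.
  by rewrite mD subrr mulr0 => /eqP; rewrite subr_eq0 => /eqP.
have mD2 := congr1 (fun u => k * u) mD.
have mD3 := congr1 (fun u => k ^+ 2 * u) mD.
have frame : heis_frame n (2 * k * m ^+ 2 *: z) (vec 0 (- m) s t) (vec m 0 (- t) s)
    (vec (k * - m) 0 (k * - t) (k * s)) (vec 0 (k * - m) (k * - s) (k * - t)) (- c^-1 *: e).
  rewrite /= in mD2 mD3; apply: vec_frame; first [ring | lra | idtac].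
  - by rewrite mulf_neq0 ?expf_neq0 // mulf_neq0 ?pnatr_eq0.
  - by rewrite oppr_eq0 invr_neq0.
apply: (lie_isom_null_frame dimL frame (@null_bracket_167 R));
  rewrite lieZl lie_e_vec !(scale0r, scale1r, oppr0, add0r, subr0, addr0) !(vecZ, vecN, vecD);
  congr vec; rewrite /k;
  first [by field | by apply: (eqD c^-1); field | by apply: (eqD (k / c)); rewrite /k; field
    | by apply: (eqD (- (k / c))); rewrite /k; field].
Qed.

(** Here B = 0 and A = c J: both planes turn with the same speed, and the algebra is s6.166 with a =
    - 1. *)
Lemma listed_of_scalar : m = 0 -> D = 0 -> c != 0 -> listed L.
Proof.
move=> m0 /eqP; rewrite paddr_eq0 ?sqr_ge0 // !sqrf_eq0 => /andP[/eqP s0 /eqP t0] c0.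
have [z_in_n xn x'n yn y'n] := mem_n.
apply: (@listed_elliptic _ _ n dimL z x x' y y' e c c) => //.
- by rewrite ex m0 s0 t0 /vec !(oppr0, scale0r, addr0, add0r).
- by rewrite ex' m0 s0 t0 /vec !(oppr0, scale0r, addr0, add0r) scaleNr.
- by rewrite ey m0 s0 t0 /vec !(oppr0, scale0r, addr0, add0r).
- by rewrite ey' m0 s0 t0 /vec !(oppr0, scale0r, addr0, add0r) scaleNr.
- by left.
Qed.

(** If c = 0 then A = B squares to zero, and the lower central series of L descends inside <z> + im
    (ad e), then <z>, then 0. *)
Lemma not_nil_parabolic : m ^+ 2 = D -> c != 0.
Proof.
move=> mD; apply/eqP=> c0; apply: not_nil.
have ze : lie e z = 0 by rewrite lieC zc oppr0.
have AA a b p q : lie e (lie e (vec a b p q)) = 0.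
  have mk u := congr1 (fun v => u * v) mD; rewrite /D /= in mk.
  rewrite !lie_e_vec c0 (_ : 0 = vec 0 0 0 0); last by rewrite /vec !scale0r !addr0.
  by congr vec; move: (mk a) (mk b) (mk p) (mk q); lra.
have vecz u a b p q : exists k l, lie u (vec a b p q) = k *: z + l *: lie e (vec a b p q).
  have [a' [b' [p' [q' [k [l ->]]]]]] := basis u.
  exists (a' * b - b' * a - (p' * q - q' * p)), l.
  by rewrite 2!lieDl 2!lieZl zc scaler0 add0r lie_vec.
pose W := (<[z]> + limg (ad e))%VS.
have W1 : (lower_central fullv 1 <= W)%VS.
  apply/lie_prod_subP=> u v _ _.
  have [a [b [p [q [k [l ->]]]]]] := basis v.
  have [k' [l' uE]] := vecz u a b p q.
  rewrite 2!lieDr 2!lieZr uE [lie u z]lieC zc oppr0 scaler0 add0r -addrA.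
  apply: memv_add; first by rewrite memvZ ?memv_line.
  rewrite memvD ?memvZ // ?lieNr -?adE ?memv_img ?memvf //.
  by rewrite adE lieC memvN -adE memv_img ?memvf.
have W2 : (lower_central fullv 2 <= <[z]>)%VS.
  apply/lie_prod_subP=> u v _ /(subvP W1) /memv_addP[_ /vlineP[k ->]].
  move=> [_ /memv_imgP[v' _ ->] ->]; rewrite adE.
  have [a [b [p [q [k1 [l1 ->]]]]]] := basis v'.
  rewrite lieDr lieZr [lie u z]lieC zc oppr0 scaler0 add0r.
  have -> : lie e (k1 *: z + vec a b p q + l1 *: e) = lie e (vec a b p q).
    by rewrite 2!lieDr 2!lieZr ze scaler0 add0r liexx scaler0 addr0.
  rewrite lie_e_vec.
  have [k' [l' ->]] := vecz u (- (c + m) * b + s * p + t * q) ((c + m) * a - t * p + s * q)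
      (s * a - t * b - (c - m) * q) (t * a + s * b + (c - m) * p).
  by rewrite -lie_e_vec AA scaler0 addr0 memvZ ?memv_line.
exists 3%N; apply/eqP; rewrite -subv0.
apply/lie_prod_subP=> u v _ /(subvP W2) /vlineP[k ->].
by rewrite lieZr [lie u z]lieC zc oppr0 scaler0 mem0v.
Qed.

Lemma listed_ad_e : listed L.
Proof.
have [ltD|ltD|eqD] := ltgtP D (m ^+ 2).
- exact: listed_of_elliptic.
- exact: listed_of_hyperbolic.
have c0 := not_nil_parabolic (esym eqD).
have [m0|m0] := eqVneq m 0; last exact: listed_of_parabolic.
by apply: listed_of_scalar; rewrite // eqD m0 expr0n.
Qed.

End Classify.

(** * From a balanced structure to a unitary frame *)

Section Geometry.
Variables (R : realType) (L : lieAlgType R) (n : {vspace L}).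
Variables (J : 'End(L)) (g : {dot L for idfun}) (z : L).
Hypothesis dimL : \dim {:L} = 6%N.
Hypothesis nil_n : is_nilradical n.
Hypothesis dim_n : \dim n = 5%N.
Hypothesis unimod : strongly_unimodular n.
Hypothesis z_neq0 : z != 0.
Hypothesis n1E : lower_central n 1 = <[z]>%VS.
Hypothesis balancedJ : balanced J g.
Hypothesis perpE : (J @: lower_central n 1)%VS = orthov g n.

Let e := J z.

Lemma JJ u : J (J u) = - u.
Proof. by case: balancedJ => -[[]]. Qed.

Lemma nijenhuis0 u v : nijenhuis J u v = 0.
Proof. by case: balancedJ => -[[]]. Qed.

Lemma dotJ u v : g (J u) (J v) = g u v.
Proof. by case: balancedJ => -[]. Qed.

Lemma dotDr u v w : g u (v + w) = g u v + g u w. Proof. exact: linearD. Qed.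
Lemma dotZr a u v : g u (a *: v) = a * g u v. Proof. exact: linearZ. Qed.
Lemma dotNr u v : g u (- v) = - g u v. Proof. exact: linearN. Qed.
Lemma dotDl u v w : g (u + v) w = g u w + g v w.
Proof. by rewrite dotC dotDr !(dotC _ w). Qed.
Lemma dotZl a u v : g (a *: u) v = a * g u v.
Proof. by rewrite dotC dotZr (dotC _ v). Qed.
Lemma dotNl u v : g (- u) v = - g u v.
Proof. by rewrite dotC dotNr (dotC _ v). Qed.

Lemma dot_gt0 u : u != 0 -> 0 < g u u.
Proof. exact: neq0_dnorm_gt0. Qed.

Lemma dotJl u v : g (J u) v = - g u (J v).
Proof. by rewrite -dotJ JJ dotNl. Qed.

Lemma J_neq0 u : u != 0 -> J u != 0.
Proof.
by apply: contra_neq => Ju; rewrite -[LHS]opprK -(JJ u) Ju linear0 oppr0.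
Qed.

Lemma ideal_n u v : v \in n -> lie u v \in n.
Proof. by case: nil_n => /lie_idealP idn _ _; apply: idn. Qed.

Lemma lie_n u v : u \in n -> v \in n -> lie u v \in <[z]>%VS.
Proof. by move=> un vn; rewrite -n1E memv_lie_prod. Qed.

Lemma z_in_n : z \in n.
Proof.
have : (lower_central n 1 <= n)%VS by apply/lie_prod_subP=> u v _ /(ideal_n u).
by rewrite n1E -memvE.
Qed.

Lemma e_orth u : u \in n -> g e u = 0.
Proof.
move=> un; have /mem_orthovP : e \in orthov g n.
  by rewrite -perpE memv_img // n1E memv_line.
exact.
Qed.

Lemma e_notin : e \notin n.
Proof.
apply/negP=> /e_orth ee; have := dot_gt0 (J_neq0 z_neq0).
by rewrite [g _ _]ee ltxx.
Qed.

Lemma decomp u : exists2 w, w \in n & exists l, u = w + l *: e.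
Proof.
have /eqP full : (n + <[e]> == fullv)%VS.
  rewrite eqEdim subvf dimL dimv_disjoint_sum ?dim_n ?dim_vline ?J_neq0 //.
  apply/eqP; rewrite -subv0; apply/subvP=> v /memv_capP[vn /vlineP[k vE]].
  rewrite memv0 vE; have [->|k0] := eqVneq k 0; first by rewrite scale0r.
  by have := e_notin; rewrite -[e](scalerK k0) -vE memvZ.
have /memv_addP[w wn [_ /vlineP[l ->] ->]] : u \in (n + <[e]>)%VS by rewrite full memvf.
by exists w => //; exists l.
Qed.

(** If [u, z] = k z with k nonzero, iterated brackets with u would never kill z, against nilpotency
    of n. *)
Lemma lie_nz u : u \in n -> lie u z = 0.
Proof.
move=> un; have /vlineP[k kE] := lie_n un z_in_n.
have [k0|k0] := eqVneq k 0; first by rewrite kE k0 scale0r.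
have [_ nn _] := nil_n.
have [||a a0 /esym/eqP] := @ad_stable_not_nilpotent _ _ n u z
   (fun v => exists2 a, a != 0 & v = a *: z) nn un z_in_n.
- by exists 1; rewrite ?oner_neq0 ?scale1r.
- move=> _ [a a0 ->]; exists (a * k); first exact: mulf_neq0.
  by rewrite lieZr kE scalerA.
by rewrite scaler_eq0 (negPf z_neq0) orbF (negPf a0).
Qed.

Lemma lower_central_n2 : lower_central n 2 = 0%VS.
Proof.
apply/eqP; rewrite lower_centralS n1E -subv0; apply/lie_prod_subP=> u _ un /vlineP[k ->].
by rewrite lieZr lie_nz // scaler0 mem0v.
Qed.

(** The line n^1 = <z> is stable under ad e and n^2 = 0, so the trace condition at level 1 is the
    eigenvalue at z. *)
Lemma lie_ez : lie e z = 0.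
Proof.
have : lie e z \in <[z]>%VS.
  rewrite -n1E -adE memv_preim; have : z \in lower_central n 1 by rewrite n1E memv_line.
  apply/subvP; apply/lie_prod_subP=> u v un vn; rewrite -memv_preim adE lie_jacobiD.
  by rewrite memvD // memv_lie_prod // ideal_n.
move=> /vlineP[k kE]; rewrite kE.
suff -> : k = 0 by rewrite scale0r.
have := unimod e 1; rewrite lower_central_n2 n1E.
rewrite (@lftrace_quot_end _ _ 1 _ _ _ [tuple z] (fun _ _ => k)) ?big_ord1 //.
- exact: sub0v.
- by rewrite limg0 subvv.
- by move=> i; rewrite ord1 memv_line.
- move=> d; rewrite big_ord1 memv0 scaler_eq0 (negPf z_neq0) orbF => /eqP d0 i.
  by rewrite ord1.
- by rewrite dimv0 dim_vline z_neq0.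
- by move=> i; rewrite ord1 adE kE subrr mem0v.
Qed.

Lemma z_central u : lie z u = 0.
Proof.
have [w wn [l ->]] := decomp u.
by rewrite lieDr lieZr lieC lie_nz // lieC lie_ez !oppr0 scaler0 addr0.
Qed.

(** The space k of the overview: it lies in n, hence is orthogonal to e as well. *)
Definition hspace : {vspace L} := (n :&: orthov g <[z]>)%VS.

Lemma mem_hspace w : (w \in hspace) = (w \in n) && (g z w == 0).
Proof. by rewrite memv_cap mem_orthov1 dotC. Qed.

Lemma hspace_n w : w \in hspace -> w \in n.
Proof. by rewrite mem_hspace => /andP[]. Qed.

Lemma hspace_z w : w \in hspace -> g z w = 0.
Proof. by rewrite mem_hspace => /andP[_ /eqP]. Qed.

Lemma hspace_e w : w \in hspace -> g e w = 0.
Proof. by move=> /hspace_n /e_orth. Qed.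

Lemma n_orth w : g e w = 0 -> w \in n.
Proof.
have [v vn [l ->]] := decomp w.
rewrite dotDr dotZr e_orth // add0r => /eqP.
rewrite mulf_eq0 [_ == 0 in X in _ || X]gt_eqF ?orbF; last exact/dot_gt0/J_neq0.
by move=> /eqP->; rewrite scale0r addr0.
Qed.

Lemma hspace_J w : w \in hspace -> J w \in hspace.
Proof.
move=> wk; rewrite mem_hspace n_orth; last by rewrite dotJ hspace_z.
by rewrite -[g _ _]opprK -dotJl hspace_e // oppr0 eqxx.
Qed.

Lemma dim_hspace : \dim hspace = 4%N.
Proof.
rewrite /hspace -eq_dim_orthov1 ?dim_n //; apply/mem_orthovPn; exists z; first exact: z_in_n.
by rewrite gt_eqF // dot_gt0.
Qed.

Lemma hspace_decomp u : exists2 w, w \in hspace & exists k l, u = k *: z + w + l *: e.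
Proof.
have [v vn [l ->]] := decomp u; exists (v - (g z v / g z z) *: z).
  rewrite mem_hspace memvB ?memvZ ?z_in_n //= dotDr dotNr dotZr divfK ?subrr ?eqxx //.
  by rewrite gt_eqF // dot_gt0.
by exists (g z v / g z z), l; rewrite addrC [_ *: z + _]addrC subrK addrC.
Qed.

Lemma lie_eJ w : w \in hspace -> lie e (J w) = J (lie e w).
Proof.
move=> wk; have := nijenhuis0 z w.
by rewrite /nijenhuis !z_central linear0 !subr0 => /eqP; rewrite subr_eq0 => /eqP.
Qed.

(** g (z, A w) = g (e, J A w) = g (e, A J w), and A J w stays in the ideal n, orthogonal to e. *)
Lemma hspace_lie_e w : w \in hspace -> lie e w \in hspace.
Proof.
move=> wk; rewrite mem_hspace ideal_n ?hspace_n //=.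
by rewrite -dotJ -lie_eJ // [g _ _]e_orth ?eqxx // ideal_n // hspace_n // hspace_J.
Qed.

Definition eta u v := g z (lie u v) / g z z.

Lemma lieE u v : u \in n -> v \in n -> lie u v = eta u v *: z.
Proof.
move=> un vn; rewrite /eta; have /vlineP[k ->] := lie_n un vn.
by rewrite dotZr mulfK // gt_eqF // dot_gt0.
Qed.

Lemma etaC u v : eta u v = - eta v u.
Proof. by rewrite /eta lieC dotNr mulNr. Qed.
Lemma etaDr u v w : eta u (v + w) = eta u v + eta u w.
Proof. by rewrite /eta lieDr dotDr mulrDl. Qed.
Lemma etaZr a u v : eta u (a *: v) = a * eta u v.
Proof. by rewrite /eta lieZr dotZr mulrA. Qed.
Lemma etaNr u v : eta u (- v) = - eta u v.
Proof. by rewrite /eta lieNr dotNr mulNr. Qed.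
Lemma etaDl u v w : eta (u + v) w = eta u w + eta v w.
Proof. by rewrite /eta lieDl dotDr mulrDl. Qed.
Lemma etaZl a u v : eta (a *: u) v = a * eta u v.
Proof. by rewrite /eta lieZl dotZr mulrA. Qed.
Lemma etaNl u v : eta (- u) v = - eta u v.
Proof. by rewrite /eta lieNl dotNr mulNr. Qed.
Lemma eta_xx u : eta u u = 0.
Proof. by rewrite /eta liexx -[0](scale0r z) dotZr !mul0r. Qed.

Lemma eta_A u v : u \in hspace -> v \in hspace -> eta (lie e u) v + eta u (lie e v) = 0.
Proof.
move=> uk vk; have := lie_jacobiD e u v.
rewrite (lieE (hspace_n uk) (hspace_n vk)) lieZr lie_ez scaler0.
rewrite (lieE _ (hspace_n vk)) ?(lieE (hspace_n uk)) ?ideal_n ?hspace_n // -scalerDl.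
by move=> /esym/eqP; rewrite scaler_eq0 (negPf z_neq0) orbF => /eqP.
Qed.

(** This is the z-component of the Nijenhuis tensor: the two mixed brackets contribute multiples of
    J z = e, orthogonal to z. *)
Lemma eta_J u v : u \in hspace -> v \in hspace -> eta (J u) (J v) = eta u v.
Proof.
move=> uk vk; have := nijenhuis0 u v; rewrite /nijenhuis.
rewrite !lieE ?hspace_n ?hspace_J // !linearZ /= -/e => /(congr1 (g z)).
rewrite !(dotDr, dotNr, dotZr) (dotC g z e) e_orth ?z_in_n //.
rewrite oppr0 !mulr0 !addr0 mulrN -mulrBl -[0](scale0r z) dotZr mul0r => /eqP.
by rewrite mulf_eq0 subr_eq0 orbC gt_eqF ?dot_gt0 //= => /eqP.
Qed.

Lemma eta_Jl u v : u \in hspace -> v \in hspace -> eta (J u) v = - eta u (J v).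
Proof. by move=> uk vk; rewrite -eta_J ?hspace_J // JJ etaNl. Qed.

Lemma n_decomp v : v \in n -> exists2 w, w \in hspace & exists k, v = k *: z + w.
Proof.
move=> vn; have [w wk [k [l vE]]] := hspace_decomp v; exists w => //; exists k.
have : g e v = 0 by rewrite e_orth.
rewrite vE !dotDr !dotZr e_orth ?z_in_n // hspace_e // mulr0 !add0r => /eqP.
rewrite mulf_eq0 [_ == 0 in X in _ || X]gt_eqF ?orbF; last exact/dot_gt0/J_neq0.
by move=> /eqP->; rewrite scale0r addr0.
Qed.

Lemma exists_nonnull : exists2 x, x \in hspace & eta x (J x) != 0.
Proof.
apply: contrapT => noX.
have null x : x \in hspace -> eta x (J x) = 0.
  by move=> xk; apply/eqP/negPn/negP=> ?; apply: noX; exists x.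
have eta0 u v : u \in hspace -> v \in hspace -> eta u v = 0.
  move=> uk vk; have wk : - J v \in hspace by rewrite memvN hspace_J.
  have Jw : J (- J v) = v by rewrite linearN /= JJ opprK.
  have := null _ (memvD uk wk); rewrite linearD /= Jw etaDl !etaDr null // add0r.
  have := null _ wk; rewrite Jw => ->.
  by rewrite addr0 etaNl eta_J // (etaC v) opprK; lra.
have : (lower_central n 1 <= 0)%VS.
  apply/lie_prod_subP=> u v /n_decomp[u' uk [a ->]] /n_decomp[v' vk [b ->]].
  rewrite lieDl lieZl z_central scaler0 add0r lieDr lieZr lieC z_central oppr0 scaler0 add0r.
  by rewrite lieE ?hspace_n // eta0 // scale0r mem0v.
by rewrite n1E subv0 -dimv_eq0 dim_vline z_neq0.
Qed.

(** One Gram-Schmidt step for eta and J, starting from a vector outside <x, J x>; the coefficients a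
    and b solve the two eta-equations. Only the length of y refers to g. *)
Lemma exists_orthogonal x : x \in hspace -> eta x (J x) != 0 ->
  exists y, [/\ y \in hspace, eta x y = 0, eta x (J y) = 0, y != 0 & g y y = g x x].
Proof.
move=> xk h0; have Jxk := hspace_J xk.
have /subvPn[y0 y0k y0n] : ~~ (hspace <= <<[:: x; J x]>>)%VS.
  apply/negP=> /dimvS; rewrite dim_hspace => le4.
  by have := leq_trans le4 (dim_span _).
pose a := eta x y0 / eta x (J x); pose b := eta x (J y0) / eta x (J x).
pose y1 := y0 - (a *: J x + b *: x).
have y1k : y1 \in hspace by rewrite memvB // memvD ?memvZ.
have y1n0 : y1 != 0.
  apply: contra y0n; rewrite subr_eq0 => /eqP->.
  by rewrite memvD // memvZ // memv_span // !inE eqxx ?orbT.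
have xy1 : eta x y1 = 0.
  by rewrite /y1 !(etaDr, etaNr, etaZr) eta_xx /a; field.
have xJy1 : eta x (J y1) = 0.
  rewrite /y1 linearB linearD !linearZ /= JJ !(etaDr, etaNr, etaZr) eta_xx /b.
  by field.
have x0 : x != 0 by apply: contraNneq h0 => ->; rewrite -(scale0r x) etaZl mul0r.
have gx := dot_gt0 x0; have gy := dot_gt0 y1n0.
pose r := Num.sqrt (g x x / g y1 y1).
have r2 : r ^+ 2 = g x x / g y1 y1 by rewrite sqr_sqrtr // divr_ge0 ?ltW.
exists (r *: y1); split.
- exact: memvZ.
- by rewrite etaZr xy1 mulr0.
- by rewrite linearZ etaZr xJy1 mulr0.
- by rewrite scaler_eq0 negb_or y1n0 andbT sqrtr_eq0 -ltNge divr_gt0.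
- by rewrite dotZl dotZr mulrA -expr2 r2 divfK // gt_eqF.
Qed.

(** * The derivation A in an eta-orthogonal frame *)

Section Frame.
Variables x y : L.
Hypotheses (xk : x \in hspace) (yk : y \in hspace) (y_neq0 : y != 0).
Hypothesis h_neq0 : eta x (J x) != 0.
Hypotheses (xy : eta x y = 0) (xJy : eta x (J y) = 0) (gxy : g y y = g x x).

Let Jxk := hspace_J xk.
Let Jyk := hspace_J yk.
Let X := [tuple x; J x; y; J y].

Let Jx_y : eta (J x) y = 0.
Proof. by rewrite eta_Jl // xJy oppr0. Qed.

Let Jx_Jy : eta (J x) (J y) = 0.
Proof. by rewrite eta_J. Qed.

(** Pairing with J x and x through eta kills the first two coefficients. As eta may still vanish on
    y and J y, the rest of the relation, (c + d J) y = 0, is multiplied by c - d J instead. *)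
Lemma basis_hspace : basis_of hspace X.
Proof.
rewrite basisEfree dim_hspace leqnn andbT; apply/andP; split; last first.
  by apply/span_subvP=> v; rewrite !inE => /or4P[] /eqP->.
apply/freeP=> k; rewrite !big_ord_recl big_ord0 /= addr0.
set a := k _; set b := k _; set c := k _; set d := k _ => k0.
have a0 : a = 0.
  have := congr1 (fun u => eta u (J x)) k0.
  rewrite !(etaDl, etaZl) eta_xx (etaC y) (etaC (J y)) Jx_y Jx_Jy.
  rewrite -(scale0r x) etaZl !(oppr0, mulr0, addr0, mul0r) => /eqP.
  by rewrite mulf_eq0 (negPf h_neq0) orbF => /eqP.
have b0 : b = 0.
  have := congr1 (fun u => eta u x) k0.
  rewrite !(etaDl, etaZl) eta_xx (etaC y) (etaC (J y)) (etaC (J x)) xy xJy.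
  rewrite -(scale0r x) etaZl !(oppr0, mulr0, addr0, add0r, mul0r, mulrN) => /eqP.
  by rewrite oppr_eq0 mulf_eq0 (negPf h_neq0) orbF => /eqP.
move: k0; rewrite a0 b0 !scale0r !add0r => cd0.
have : (c ^+ 2 + d ^+ 2) *: y = 0.
  have Jcd0 : c *: J y - d *: y = 0.
    by have := congr1 J cd0; rewrite linearD !linearZ /= JJ linear0 scalerN.
  have := congr2 (fun u v => c *: u - d *: v) cd0 Jcd0.
  rewrite scalerDr scalerBr !scalerA !scaler0 subr0 => <-.
  by rewrite opprB addrACA (mulrC d c) subrr addr0 -scalerDl -!expr2.
move=> /eqP; rewrite scaler_eq0 (negPf y_neq0) orbF paddr_eq0 ?sqr_ge0 //.
rewrite !sqrf_eq0 => /andP[/eqP c0 /eqP d0].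
by case=> [[|[|[|[|//]]]] i4]; [rewrite -[RHS]a0 | rewrite -[RHS]b0 | rewrite -[RHS]c0
  | rewrite -[RHS]d0]; congr k; apply: val_inj.
Qed.

Lemma hspace_comb w : w \in hspace ->
  exists a b p q, w = a *: x + b *: J x + p *: y + q *: J y.
Proof.
move=> /(coord_basis basis_hspace) wE.
exists (coord X ord0 w), (coord X (inord 1) w), (coord X (inord 2) w), (coord X (inord 3) w).
rewrite {1}wE !big_ord_recl big_ord0 /= addr0 !addrA.
by do !congr (_ + _); congr (coord _ _ _ *: _); apply: val_inj; rewrite /= inordK.
Qed.

Let h := eta x (J x).

(** The frame represents n / [n, n], where A commutes with J and so has trace 2 (a1 + b3);
    unimodularity at level 0 applies. *)
Lemma trace_zero a1 a2 a3 a4 b1 b2 b3 b4 :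
  lie e x = a1 *: x + a2 *: J x + a3 *: y + a4 *: J y ->
  lie e y = b1 *: x + b2 *: J x + b3 *: y + b4 *: J y -> a1 + b3 = 0.
Proof.
move=> Ax Ay.
have AJx : lie e (J x) = - a2 *: x + a1 *: J x + - a4 *: y + a3 *: J y.
  rewrite lie_eJ // Ax !linearD !linearZ /= !JJ !scalerN !scaleNr.
  by rewrite addrAC [_ + - (a2 *: x)]addrC -!addrA; congr (_ + (_ + _)); rewrite addrC.
have AJy : lie e (J y) = - b2 *: x + b1 *: J x + - b4 *: y + b3 *: J y.
  rewrite lie_eJ // Ay !linearD !linearZ /= !JJ !scalerN !scaleNr.
  by rewrite [_ + - (b2 *: x)]addrC -!addrA; congr (_ + (_ + _)); rewrite addrC.
pose c (i j : 'I_4) := nth 0 (nth [::]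
  [:: [:: a1; a2; a3; a4]; [:: - a2; a1; - a4; a3];
      [:: b1; b2; b3; b4]; [:: - b2; b1; - b4; b3]] i) j.
have dimz : \dim (lower_central n 1) = 1%N by rewrite n1E dim_vline z_neq0.
have Xk (i : 'I_4) : X`_i \in hspace.
  by case: i => -[|[|[|[|//]]]] ?.
have := unimod e 0; rewrite (@lftrace_quot_end _ _ 4 _ _ _ X c).
- rewrite !big_ord_recl big_ord0 /c /= => H; lra.
- by rewrite n1E -memvE z_in_n.
- by rewrite n1E limg_line adE lie_ez sub0v.
- by move=> i; apply: hspace_n.
- move=> d; rewrite n1E => /vlineP[k dE]; apply/freeP; first exact: (basis_free basis_hspace).
  have dk : \sum_i d i *: X`_i \in hspace by apply: memv_suml => i _; apply/memvZ/Xk.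
  move: (hspace_z dk); rewrite dE dotZr => /eqP.
  rewrite mulf_eq0 [_ == 0 in X in _ || X]gt_eqF ?dot_gt0 // orbF => /eqP->.
  by rewrite scale0r.
- by rewrite dimz dim_n.
move=> i; suff -> : ad e X`_i = \sum_j c i j *: X`_j by rewrite subrr mem0v.
rewrite adE !big_ord_recl big_ord0 /c /= addr0 !addrA.
by case: i => -[|[|[|[|//]]]] ? /=.
Qed.

(** By eta-orthogonality the derivation rule on (x, J x) reduces to 2 a1 h = 0. *)
Lemma ad_e_xx_eq0 a1 a2 a3 a4 :
  lie e x = a1 *: x + a2 *: J x + a3 *: y + a4 *: J y -> a1 = 0.
Proof.
move=> Ax; have := eta_A xk Jxk; rewrite lie_eJ // Ax.
rewrite !(linearD, linearZ) /= !JJ !(etaDr, etaDl, etaZr, etaZl, etaNr) !eta_xx.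
rewrite (etaC y) (etaC (J y)) Jx_y Jx_Jy xy xJy => H.
have : 2 * a1 * h = 0 by rewrite -H /h; ring.
move=> /eqP; rewrite mulf_eq0 [_ == 0 in X in _ || X](negPf h_neq0) orbF.
by rewrite mulf_eq0 pnatr_eq0 => /eqP.
Qed.

(** The missing x-term of A x and y-term of A y encode tr A = 0, so A contributes nothing: it acts
    on the volume form omega ^ 2 of k by its trace. The brackets [x, J x] and [y, J y] contribute h
    g (y, y) and eta (y, J y) g (x, x), up to a common factor, and the two lengths agree. *)
Lemma eta_y a2 a3 a4 b1 b2 b4 :
  lie e x = a2 *: J x + a3 *: y + a4 *: J y ->
  lie e y = b1 *: x + b2 *: J x + b4 *: J y -> eta y (J y) = - h.
Proof.
move=> Ax Ay.
have [herm dpf0] := (balancedP J g dimL).1 balancedJ.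
have := dpf0 x (J x) y (J y) e; rewrite /dpf.
rewrite (lieC x e) (lieC (J x) e) (lieC y e) (lieC (J y) e) !lie_eJ // Ax Ay.
rewrite !lieE ?hspace_n // xy xJy Jx_y Jx_Jy !scale0r.
have JN u : J (- u) = - J u by exact: linearN.
have JD u v : J (u + v) = J u + J v by exact: linearD.
have JZ k u : J (k *: u) = k *: J u by exact: linearZ.
have dot0l u : g 0 u = 0 by rewrite -(scale0r u) dotZl mul0r.
rewrite /pf4 !(JN, JD, JZ, JJ, linear0) -/e.
rewrite !(dotDl, dotZl, dotNl, dotDr, dotZr, dotNr, dot0l).
have ge w : w \in hspace -> g w e = 0 by move=> wk; rewrite dotC hspace_e.
have gJ u : g u (J u) = 0.
  by apply/eqP; rewrite -[_ == 0](mulrn_eq0 _ 2) mulr2n {1}dotC dotJl addNr.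
have gJ' u : g (J u) u = 0 by rewrite dotC gJ.
have yx : g y x = g x y by rewrite dotC.
have Jxy : g (J x) y = - g x (J y) by rewrite dotJl.
have yJx : g y (J x) = - g x (J y) by rewrite dotC dotJl.
have Jyx : g (J y) x = g x (J y) by rewrite dotC.
rewrite !(hspace_e xk, hspace_e yk, hspace_e Jxk, hspace_e Jyk, ge _ xk, ge _ yk, ge _ Jxk, ge _ Jyk).
rewrite !(dotJ, gJ, gJ', yx, Jxy, yJx, Jyx, gxy) -/h => E0.
have gzz := dot_gt0 z_neq0; have gxx : 0 < g x x by rewrite -gxy dot_gt0.
have : (h + eta y (J y)) * (g z z * g x x) = 0 by rewrite -[RHS]oppr0 -E0; ring.
move=> /eqP; rewrite mulf_eq0 orbC gt_eqF ?mulr_gt0 //=.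
by rewrite addrC addr_eq0 => /eqP.
Qed.

End Frame.

Lemma balanced_listed : listed L.
Proof.
have [x xk h0] := exists_nonnull.
have [y [yk xy xJy y0 gxy]] := exists_orthogonal xk h0.
set h := eta x (J x) in h0.
have comb w := hspace_comb xk yk y0 h0 xy xJy (w := w).
have Jxk := hspace_J xk; have Jyk := hspace_J yk.
have [a1 [a2 [a3 [a4 Ax]]]] := comb _ (hspace_lie_e xk).
have [b1 [b2 [b3 [b4 Ay]]]] := comb _ (hspace_lie_e yk).
have a10 := ad_e_xx_eq0 xk yk h0 xy xJy Ax.
have b30 : b3 = 0 by have := trace_zero xk yk y0 h0 xy xJy Ax Ay; rewrite a10 add0r.
move: Ax Ay; rewrite a10 b30 !scale0r add0r addr0 => Ax Ay {a1 b3 a10 b30}.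
have yJy : eta y (J y) = - h by apply: (@eta_y x y) Ax Ay.
have Jx_y : eta (J x) y = 0 by rewrite eta_Jl // xJy oppr0.
have Jx_Jy : eta (J x) (J y) = 0 by rewrite eta_J.
have JD u v : J (u + v) = J u + J v by exact: linearD.
have JZ k u : J (k *: u) = k *: J u by exact: linearZ.
have AJx : lie e (J x) = - a2 *: x + a3 *: J y + - a4 *: y.
  by rewrite lie_eJ // Ax !(JD, JZ, JJ) !scalerN !scaleNr.
have AJy : lie e (J y) = b1 *: J x + - b2 *: x + - b4 *: y.
  by rewrite lie_eJ // Ay !(JD, JZ, JJ) !scalerN !scaleNr.
(* The derivation rule on (x, y) and (x, J y) ties the off-diagonal entries together: this is A in
   u(1, 1). *)
have b2E : b2 = - a4.
  have := eta_A xk yk; rewrite Ax Ay !(etaDl, etaDr, etaZl, etaZr) (etaC (J y) y).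
  rewrite Jx_y eta_xx xJy yJy eta_xx -/h => H; apply: (mulIf h0).
  by move: H; rewrite !mulr0 !add0r; lra.
have b1E : b1 = a3.
  have := eta_A xk Jyk; rewrite Ax AJy !(etaDl, etaDr, etaZl, etaZr).
  rewrite Jx_Jy eta_xx yJy eta_xx xy -/h => H; apply: (mulIf h0); lra.
have cm : (a2 + b4) / 2 + (a2 - b4) / 2 = a2 by field.
have cm' : (a2 + b4) / 2 - (a2 - b4) / 2 = b4 by field.
(* c and m are the half-sum and half-difference of the J-diagonal entries of A; z is replaced by h z
   = [x, J x]. *)
apply: (@listed_ad_e R L n dimL (h *: z) x (J x) y (J y) e
  ((a2 + b4) / 2) ((a2 - b4) / 2) a3 a4).
- by rewrite scaler_eq0 negb_or h0.
- by split; [apply/memvZ/z_in_n | apply: hspace_n ..].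
- exact: e_notin.
- by move=> u; rewrite lieZl z_central scaler0.
- by rewrite lieE ?hspace_n.
- by rewrite lieE ?hspace_n // yJy scaleNr.
- by rewrite lieE ?hspace_n // xy scale0r.
- by rewrite lieE ?hspace_n // xJy scale0r.
- by rewrite lieE ?hspace_n // Jx_y scale0r.
- by rewrite lieE ?hspace_n // Jx_Jy scale0r.
- by rewrite cm Ax /vec scale0r add0r.
- by rewrite cm AJx /vec scale0r addr0 addrAC.
- by rewrite cm' Ay b1E b2E /vec scale0r addr0.
- by rewrite cm' AJy b1E b2E opprK /vec scale0r addr0 [a3 *: _ + _]addrC.
- move=> u; have [w wk [k [l ->]]] := hspace_decomp u; have [a [b [p [q ->]]]] := comb w wk.
  by exists a, b, p, q, (k / h), l; rewrite scalerA divfK.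
move=> nL; have [_ _ maxn] := nil_n.
have fulln : (fullv <= n)%VS by apply: maxn => //; exact: subvf.
by have := dimvS fulln; rewrite dimL dim_n.
Qed.

End Geometry.

Theorem theorem6p4 (R : realType) :
  (forall (L : lieAlgType R) (n : {vspace L}),
     \dim {:L} = 6%N ->
     is_nilradical n ->
     almost_nilpotent n ->
     strongly_unimodular n ->
     \dim (lower_central n 1) = 1%N ->
     (exists (J : 'End(L)) (g : {dot L for idfun}), balanced_perp n J g)
     <->
     (lie_isom L (lie_of_eqs (s6_159 R))
      \/ lie_isom L (lie_of_eqs (s6_162_1 R))
      \/ (exists a : R, 0 < a /\ lie_isom L (lie_of_eqs (s6_165 a)))
      \/ (exists a : R, 0 < `|a| <= 1 /\ lie_isom L (lie_of_eqs (s6_166 a)))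
      \/ lie_isom L (lie_of_eqs (s6_167 R))))
  /\
  [/\ balanced_example (E := s6_159 R) (@J_16_24_35 R _),
      (forall a : R, 0 < `|a| <= 1 ->
         balanced_example (E := s6_166 a) (@J_16_24_35 R _)),
      balanced_example (E := s6_162_1 R) (@J_16_23_45 R _),
      (forall a : R, 0 < a ->
         balanced_example (E := s6_165 a) (@J_16_23_45 R _)) &
      balanced_example (E := s6_167 R) (@J_16_23_45 R _)].
Proof.
split.
  move=> L n dimL nil_n [_ dim_n] unimod dim1; split.
    move=> [J [g [bal perp]]].
    have n1E : lower_central n 1 = <[vpick (lower_central n 1)]>%VS.
      apply/eqP; rewrite eq_sym eqEdim -memvE memv_pick dim1 dim_vline.
      by rewrite vpick0 -dimv_eq0 dim1.
    apply: (balanced_listed dimL nil_n _ unimod _ n1E bal perp).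
      by move: dim_n; rewrite dimL => -[].
    by rewrite vpick0 -dimv_eq0 dim1.
  move=> [iso|[iso|[[a [a0 iso]]|[[a [/andP[a0 _] iso]]|iso]]]].
  - exact: example_transport (rot_example (@rot_bracket_159 R) (oner_neq0 _)) iso nil_n.
  - apply: example_transport (null_example (@null_bracket_162 R) _) iso nil_n.
    by rewrite expr1n expr0n addr0 oner_neq0.
  - apply: example_transport (null_example (@null_bracket_165 R a) _) iso nil_n.
    by rewrite gt_eqF // ltr_wpDl ?sqr_ge0 // expr1n ltr01.
  - apply: example_transport (rot_example (@rot_bracket_166 R a) _) iso nil_n.
    by rewrite -normr_gt0.
  - apply: example_transport (null_example (@null_bracket_167 R) _) iso nil_n.
    by rewrite expr1n expr0n add0r oner_neq0.
split.
- exact: rot_example (@rot_bracket_159 R) (oner_neq0 _).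
- move=> a /andP[a0 _]; apply: rot_example (@rot_bracket_166 R a) _.
  by rewrite -normr_gt0.
- apply: null_example (@null_bracket_162 R) _.
  by rewrite expr1n expr0n addr0 oner_neq0.
- move=> a a0; apply: null_example (@null_bracket_165 R a) _.
  by rewrite gt_eqF // ltr_wpDl ?sqr_ge0 // expr1n ltr01.
- apply: null_example (@null_bracket_167 R) _.
  by rewrite expr1n expr0n add0r oner_neq0.
Qed.
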